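(* (i) There is a bijection $\Gamma:\mathbf{\Phi^+}(C_0^+(X))\to\mathbf{DTM}(X)$ given by $\Gamma(\mathcal{R})=\mu_{\mathcal{R}}$. The inverse bijection $\Pi=\Gamma^{-1}:\mathbf{DTM}(X)\to\mathbf{\Phi^+}(C_0^+(X))$ is given by $\Pi(\mu)=\mathcal{R}_\mu$. (ii) There is a bijection $\Delta:\mathbf{DTM}(X)\to\mathbf{\Phi^-}(C_0^-(X))$ given by $\Delta(\mu)=\mathcal{L}_\mu$. (iii) If $X$ is compact, there is a bijection between $\mathbf{DTM}(X)$ and $\mathbf{\Phi^r}(C(X))$ given by $\mu\mapsto\mathcal{R}_\mu$, and there is a bijection between $\mathbf{DTM}(X)$ and $\mathbf{\Phi^l}(C(X))$.
   Context: $X$ is a locally compact Hausdorff connected space; $\mathscr{O}(X),\mathscr{C}(X),\mathscr{K}(X)$ are the families of open, closed, compact subsets. $C_b(X)$, $C_0(X)$, $C_c(X)$: real continuous functions that are bounded, vanish at infinity, have compact support (sup norm); $C_0(X)=C(X)$ if $X$ is compact. $C_0^+(X)$, $C_0^-(X)$: the nonnegative, respectively nonpositive, functions in $C_0(X)$. $\operatorname{supp} f=\overline{\{f\ne 0\}}$. A deficient topological measure on $X$ is $\nu:\mathscr{C}(X)\cup\mathscr{O}(X)\to[0,\infty]$ such that: $\nu(C\sqcup K)=\nu(C)+\nu(K)$ for disjoint $C,K\in\mathscr{K}(X)$; $\nu(U)=\sup\{\nu(C): C\subseteq U, C\in\mathscr{K}(X)\}$ for open $U$; $\nu(F)=\inf\{\nu(U):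 F\subseteq U\in\mathscr{O}(X)\}$ for closed $F$. $\mathbf{DTM}(X)$ is the set of deficient topological measures with $\nu(X)<\infty$. For $f\in C_0(X)$ let $A^+(f)$ (resp. $A^-(f)$) be the set of functions $\phi\circ f$ with $\phi:\overline{f(X)}\to\mathbb{R}$ continuous and non-decreasing (resp. non-increasing), where additionally $\phi(0)=0$ is required if $X$ is not compact. Functionals take values in $[-\infty,\infty]$, attain at most one of $\pm\infty$, are not identically $\infty$ or $-\infty$, and satisfy $|\rho(0)|<\infty$. A functional $\rho$ on a domain $D\subseteq C_0(X)$ is p-conic quasi-linear if for functions in $D$: (p1) $fg=0$, $f,g\ge0$ imply $\rho(f+g)=\rho(f)+\rho(g)$; (p2) $0\le g\le f$ implies $\rho(g)\le\rho(f)$; (p3) for each $f\in C_0(X)$, if $g,h\in A^+(f)\cap D$ and $a,b\ge0$, then $\rho(ag+bh)=a\rho(g)+b\rho(h)$. It is n-conic quasi-linear if for functions in $D$: (n1) $fg=0$, $f,g\le0$ imply $\rho(f+g)=\rho(f)+\rho(g)$; (n2) $f\le g\le0$ implies $\rho(f)\le\rho(g)$; (n3) for each $f\in C_0(X)$, if $g,h\in A^-(f)\cap D$ and $a,b\ge0$, then $\rho(ag+bh)=a\rho(g)+b\rho(h)$. For compact $X$, a functional $\rho$ on $C(X)$ is an r-functional if: $\rho(af)=a\rho(f)$ for $a>0$; $0\le g\le f$ implies $\rho(g)\le\rho(f)$; if $fg=0$ and either $f,g\ge0$ or $f\ge0,g\le0$, then $\rho(f+g)=\rho(f)+\rho(g)$;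 and $\rho(f+c)=\rho(f)+\rho(c)$ for every constant $c$. It is an l-functional if: $\rho(af)=a\rho(f)$ for $a>0$; $g\le f\le0$ implies $\rho(g)\le\rho(f)$; if $fg=0$ and either $f,g\le0$ or $f\ge0,g\le0$, then $\rho(f+g)=\rho(f)+\rho(g)$; and $\rho(f+c)=\rho(f)+\rho(c)$ for every constant $c$. $\|\rho\|=\sup\{|\rho(f)|: f \text{ in the domain},\ \|f\|\le1\}$; $\rho$ is bounded if $\|\rho\|<\infty$. $\mathbf{\Phi^+}(D),\mathbf{\Phi^-}(D),\mathbf{\Phi^r}(D),\mathbf{\Phi^l}(D)$ are the families of bounded p-conic quasi-linear, n-conic quasi-linear, r- and l-functionals with domain $D$. For a functional $\rho$ whose domain contains the nonnegative functions of $C_c(X)$, $\mu_\rho(U)=\sup\{\rho(f): f\in C_c(X), 0\le f\le1, \operatorname{supp} f\subseteq U\}$ for $U$ open, and $\mu_\rho(F)=\inf\{\mu_\rho(U): F\subseteq U\in\mathscr{O}(X)\}$ for $F$ closed. For $\mu\in\mathbf{DTM}(X)$ and $f\in C_b(X)$, let $R_1(t)=\mu(f^{-1}((t,\infty)))$, $L_1(t)=\mu(f^{-1}((-\infty,t)))$; let $r$ and $l$ be the Lebesgue–Stieltjes measures on $\mathbb{R}$ associated with the non-decreasing functions $-R_1$ and $L_1$. Then $\mathcal{R}_\mu(f)=\int_{\mathbb{R}}t\,dr(t)$ and $\mathcal{L}_\mu(f)=\int_{\mathbb{R}}t\,dl(t)$; these functionals are restricted to the domain indicated. *)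

(* Defs.v *)
From HB Require Import structures.
From mathcomp Require Export all_boot all_order all_algebra.
From mathcomp Require Export all_classical all_reals all_analysis.
Set Implicit Arguments.
Unset Strict Implicit.
Unset Printing Implicit Defensive.
Import Order.TTheory GRing.Theory Num.Theory.
Export numFieldNormedType.Exports.
Local Open Scope classical_set_scope.
Local Open Scope ring_scope.

Section FunctionSpaces.
Context (X : topologicalType) (R : realType).
Implicit Types f g : continuousType X R.

Definition supp f : set X := closure [set x | f x != 0].

(* f ranges over C(X), i.e. continuousType X R *)
Definition Cfun : set (continuousType X R) := setT.
Definition Cc : set (continuousType X R) := [set f | compact (supp f)].
Definition C0 : set (continuousType X R) :=
  [set f | forall e : R, 0 < e -> compact [set x | e <= `|f x|]].
Definition C0p : set (continuousType X R) :=
  [set f | C0 f /\ forall x, 0 <= f x].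
Definition C0n : set (continuousType X R) :=
  [set f | C0 f /\ forall x, f x <= 0].

Definition supnorm f : \bar R := ereal_sup [set (`|f x|)%:E | x in setT].

(* phi is a total function on R, of which only the values on the closure of
   f(X) matter; for f in C0 and X not compact this closure contains 0. *)
Definition Aplus f : set (continuousType X R) :=
  [set g | exists phi : R -> R,
    [/\ {within closure (range f), continuous phi},
        {in closure (range f) &, {homo phi : s t / s <= t}},
        (~ compact [set: X] -> phi 0 = 0) &
        forall x, g x = phi (f x)]].

Definition Aminus f : set (continuousType X R) :=
  [set g | exists phi : R -> R,
    [/\ {within closure (range f), continuous phi},
        {in closure (range f) &, {homo phi : s t /~ s <= t}},
        (~ compact [set: X] -> phi 0 = 0) &
        forall x, g x = phi (f x)]].

End FunctionSpaces.
Arguments Cfun X R : clear implicits.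
Arguments Cc X R : clear implicits.
Arguments C0 X R : clear implicits.
Arguments C0p X R : clear implicits.
Arguments C0n X R : clear implicits.

(* A functional with domain D is a map from the type of elements of D; in the
   axioms below, a sum or a multiple is given by an element h of D with the
   prescribed values. *)
Section Functionals.
Context (X : topologicalType) (R : realType).
Variable D : set (continuousType X R).
Local Open Scope ereal_scope.
Implicit Types (rho : D -> \bar R) (f g h k : D) (a b c : R).

Definition functional rho :=
  [/\ ~ ((exists f, rho f = +oo) /\ (exists g, rho g = -oo)),
      ~ (forall f, rho f = +oo), ~ (forall f, rho f = -oo) &
      forall f, (forall x, \val f x = 0%R) -> rho f \is a fin_num].

Definition fnorm rho : \bar R :=
  ereal_sup [set `|rho f| | f in [set f : D | supnorm (\val f) <= 1]].

Definition bounded_functional rho := fnorm rho < +oo.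

Definition p_conic rho :=
  [/\ functional rho,
      (forall f g h, (forall x, \val f x * \val g x = 0)%R ->
        (forall x, 0 <= \val f x)%R -> (forall x, 0 <= \val g x)%R ->
        (forall x, \val h x = \val f x + \val g x)%R ->
        rho h = rho f + rho g),
      (forall f g, (forall x, 0 <= \val g x <= \val f x)%R -> rho g <= rho f) &
      (forall u : continuousType X R, C0 X R u ->
        forall g h k a b, Aplus u (\val g) -> Aplus u (\val h) ->
        (0 <= a)%R -> (0 <= b)%R ->
        (forall x, \val k x = a * \val g x + b * \val h x)%R ->
        rho k = a%:E * rho g + b%:E * rho h)].

Definition n_conic rho :=
  [/\ functional rho,
      (forall f g h, (forall x, \val f x * \val g x = 0)%R ->
        (forall x, \val f x <= 0)%R -> (forall x, \val g x <= 0)%R ->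
        (forall x, \val h x = \val f x + \val g x)%R ->
        rho h = rho f + rho g),
      (forall f g, (forall x, \val f x <= \val g x <= 0)%R -> rho f <= rho g) &
      (forall u : continuousType X R, C0 X R u ->
        forall g h k a b, Aminus u (\val g) -> Aminus u (\val h) ->
        (0 <= a)%R -> (0 <= b)%R ->
        (forall x, \val k x = a * \val g x + b * \val h x)%R ->
        rho k = a%:E * rho g + b%:E * rho h)].

Definition pos_homogeneous rho :=
  forall f h a, (0 < a)%R -> (forall x, \val h x = a * \val f x)%R ->
    rho h = a%:E * rho f.

Definition additive_const rho :=
  forall f k h c, (forall x, \val k x = c) ->
    (forall x, \val h x = \val f x + c)%R -> rho h = rho f + rho k.

Definition r_functional rho :=
  [/\ functional rho, pos_homogeneous rho,
      (forall f g, (forall x, 0 <= \val g x <= \val f x)%R -> rho g <= rho f),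
      (forall f g h, (forall x, \val f x * \val g x = 0)%R ->
        ((forall x, 0 <= \val f x)%R /\ (forall x, 0 <= \val g x)%R) \/
        ((forall x, 0 <= \val f x)%R /\ (forall x, \val g x <= 0)%R) ->
        (forall x, \val h x = \val f x + \val g x)%R ->
        rho h = rho f + rho g) &
      additive_const rho].

Definition l_functional rho :=
  [/\ functional rho, pos_homogeneous rho,
      (forall f g, (forall x, \val g x <= \val f x <= 0)%R -> rho g <= rho f),
      (forall f g h, (forall x, \val f x * \val g x = 0)%R ->
        ((forall x, \val f x <= 0)%R /\ (forall x, \val g x <= 0)%R) \/
        ((forall x, 0 <= \val f x)%R /\ (forall x, \val g x <= 0)%R) ->
        (forall x, \val h x = \val f x + \val g x)%R ->
        rho h = rho f + rho g) &
      additive_const rho].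

Definition Phi_p : set (D -> \bar R) :=
  [set rho | p_conic rho /\ bounded_functional rho].
Definition Phi_n : set (D -> \bar R) :=
  [set rho | n_conic rho /\ bounded_functional rho].
Definition Phi_r : set (D -> \bar R) :=
  [set rho | r_functional rho /\ bounded_functional rho].
Definition Phi_l : set (D -> \bar R) :=
  [set rho | l_functional rho /\ bounded_functional rho].

End Functionals.
Arguments Phi_p {X R} D.
Arguments Phi_n {X R} D.
Arguments Phi_r {X R} D.
Arguments Phi_l {X R} D.

Definition closed_or_open (X : topologicalType) : set (set X) :=
  [set A | closed A \/ open A].
Arguments closed_or_open X : clear implicits.

Lemma open_co (X : topologicalType) (U : set X) :
  open U -> U \in closed_or_open X.
Proof. by move=> oU; rewrite inE; right. Qed.

Definition oset (X : topologicalType) (U : set X) (oU : open U) :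
  closed_or_open X := exist _ U (open_co oU).

Section DeficientTopologicalMeasures.
Context (X : topologicalType) (R : realType).
Local Open Scope ereal_scope.
Implicit Types nu : closed_or_open X -> \bar R.

(* X is meant to be Hausdorff, so that compact sets are closed and belong to
   the domain of nu. *)
Definition deficient_topological_measure nu :=
  [/\ (forall A, 0 <= nu A),
      (forall K1 K2 K : closed_or_open X,
        compact (\val K1) -> compact (\val K2) -> \val K1 `&` \val K2 = set0 ->
        \val K = \val K1 `|` \val K2 -> nu K = nu K1 + nu K2),
      (forall U : closed_or_open X, open (\val U) ->
        nu U = ereal_sup [set nu K | K in [set K : closed_or_open X |
                            compact (\val K) /\ \val K `<=` \val U]]) &
      (forall F : closed_or_open X, closed (\val F) ->
        nu F = ereal_inf [set nu U | U in [set U : closed_or_open X |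
                            open (\val U) /\ \val F `<=` \val U]])].

Definition DTM : set (closed_or_open X -> \bar R) :=
  [set nu | deficient_topological_measure nu /\ nu (oset openT) < +oo].

Lemma DTM_le_open (mu : DTM) (U V : set X) (oU : open U) (oV : open V) :
  U `<=` V -> \val mu (oset oU) <= \val mu (oset oV).
Proof.
move=> UV; case: (set_valP mu) => -[_ _ inn _] _.
rewrite !inn //; apply: le_ereal_sup => _ [K [cK KU] <-].
by exists K => //; split => //; exact: subset_trans KU UV.
Qed.

Lemma DTM_open_fin (mu : DTM) (U : set X) (oU : open U) :
  \val mu (oset oU) \is a fin_num.
Proof.
case: (set_valP mu) => -[mu0 _ _ _] muT.
rewrite ge0_fin_numE //; apply: le_lt_trans muT.
exact: DTM_le_open.
Qed.

End DeficientTopologicalMeasures.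
Arguments DTM X R : clear implicits.

Section MeasureOfFunctional.
Context (X : topologicalType) (R : realType).
Variable D : set (continuousType X R).
Variable rho : D -> \bar R.

Definition mu_of_open (U : set X) : \bar R :=
  ereal_sup [set rho f | f in [set f : D |
    [/\ Cc X R (\val f), (forall x, 0 <= \val f x <= 1) &
        supp (\val f) `<=` U]]].

Definition mu_of (A : closed_or_open X) : \bar R :=
  if `[< open (\val A) >] then mu_of_open (\val A)
  else ereal_inf [set mu_of_open U | U in [set U | open U /\ \val A `<=` U]].

End MeasureOfFunctional.

(* The Lebesgue-Stieltjes measure m associated with a non-decreasing F, not
   assumed right-continuous: m(]a, b]) = F(b+) - F(a+). *)
Section LebesgueStieltjes.
Context (R : realType) (F : R -> R) (ndF : {homo F : s t / s <= t}).

(* F(t+) *)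
Definition right_lim of {homo F : s t / s <= t} := fun t : R =>
  inf [set F s | s in `]t, +oo[%classic].

Lemma right_lim_lb t : lbound [set F s | s in `]t, +oo[%classic] (F t).
Proof. by move=> _ [s /= + <-]; rewrite in_itv/= andbT => /ltW/ndF. Qed.

Lemma right_lim_ne t : [set F s | s in `]t, +oo[%classic] !=set0.
Proof. by exists (F (t + 1)), (t + 1) => //=; rewrite in_itv/= andbT ltrDl. Qed.

Lemma right_lim_le t s : t < s -> right_lim ndF t <= F s.
Proof.
move=> ts; apply: ge_inf; first by exists (F t); exact: right_lim_lb.
by exists s => //=; rewrite in_itv/= andbT.
Qed.

Lemma right_lim_nondecreasing : {homo right_lim ndF : s t / s <= t}.
Proof.
move=> s t st; apply: lb_le_inf; first exact: right_lim_ne.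
move=> _ [u /= + <-]; rewrite in_itv/= andbT => tu.
by apply: right_lim_le; exact: le_lt_trans tu.
Qed.

Lemma right_lim_right_continuous : right_continuous (right_lim ndF).
Proof.
move=> t; apply/cvgrPdist_le => e e0.
have [_ [s /= + <-] Fs] : exists2 y, [set F s | s in `]t, +oo[%classic] y &
    y < right_lim ndF t + e.
  apply: inf_adherent => //; split; first exact: right_lim_ne.
  by exists (F t); exact: right_lim_lb.
rewrite in_itv/= andbT => ts; near=> u.
have tu : t < u by near: u; exact: nbhs_right_gt.
have us : u < s by near: u; exact: nbhs_right_lt.
have h1 := right_lim_nondecreasing (ltW tu).
have h2 := right_lim_le us.
by rewrite ler0_norm ?subr_le0 // opprB lerBlDl; exact: le_trans h2 (ltW Fs).
Unshelve. all: by end_near. Qed.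

HB.instance Definition _ :=
  isCumulative.Build R _ R (right_lim ndF)
    right_lim_nondecreasing right_lim_right_continuous.

Definition ls_measure : set (measurableTypeR R) -> \bar R :=
  lebesgue_stieltjes_measure (right_lim ndF).

HB.instance Definition _ := Measure.on ls_measure.

End LebesgueStieltjes.

Section QuasiIntegrals.
Context (X : topologicalType) (R : realType).
Variables (mu : DTM X R) (f : continuousType X R).

Lemma open_gt_fun (t : R) : open (f @^-1` `]t, +oo[%classic).
Proof.
have /continuousP := @cts_fun _ _ f; apply; exact: rray_open.
Qed.

Lemma open_lt_fun (t : R) : open (f @^-1` `]-oo, t[%classic).
Proof.
have /continuousP := @cts_fun _ _ f; apply; exact: lray_open.
Qed.

Definition R1 (t : R) : R := fine (\val mu (oset (open_gt_fun t))).
Definition L1 (t : R) : R := fine (\val mu (oset (open_lt_fun t))).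

Lemma R1_nonincreasing : {homo (fun t => - R1 t) : s t / s <= t}.
Proof.
move=> s t st; rewrite lerN2 fine_le ?DTM_open_fin//.
apply: DTM_le_open => x /=; rewrite !in_itv/= !andbT.
exact: le_lt_trans.
Qed.

Lemma L1_nondecreasing : {homo L1 : s t / s <= t}.
Proof.
move=> s t st; rewrite fine_le ?DTM_open_fin//.
apply: DTM_le_open => x /=; rewrite !in_itv/= => h.
exact: lt_le_trans st.
Qed.

Definition Rint : \bar R := (\int[ls_measure R1_nonincreasing]_t t%:E)%E.
Definition Lint : \bar R := (\int[ls_measure L1_nondecreasing]_t t%:E)%E.

End QuasiIntegrals.

Definition calR (X : topologicalType) (R : realType)
    (D : set (continuousType X R)) (mu : DTM X R) : D -> \bar R :=
  fun f => Rint mu (\val f).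
Definition calL (X : topologicalType) (R : realType)
    (D : set (continuousType X R)) (mu : DTM X R) : D -> \bar R :=
  fun f => Lint mu (\val f).
Arguments calR {X R} D mu.
Arguments calL {X R} D mu.

(* Main.v *)
Require Import Defs.
From mathcomp Require Import all_boot all_order all_algebra.
From mathcomp Require Import all_classical all_reals all_analysis.
From mathcomp Require Import measurable_realfun.
From mathcomp Require Import ring lra.
Set Implicit Arguments.
Unset Strict Implicit.
Unset Printing Implicit Defensive.
Import Order.TTheory GRing.Theory Num.Theory.
Local Open Scope classical_set_scope.
Local Open Scope ring_scope.

(** Let [R_mu f] be the quasi-integral of [f] for a deficient topological measure
[mu].  All four bijections come from one correspondence between deficient
topological measures and functionals on the nonnegative functions of [C0].

A Stieltjes integral of the identity is determined by the distribution
[R1 f t = mu {f > t}] through a layer-cake formula, and here this formula is kept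
in the form of Riemann sums with an explicit error ([layer_cake], [ls_riemann]):
two expressions that have the same Riemann sums are equal.  In this way
monotonicity, additivity on functions with product zero ([qint_disjoint]) and
[L_mu f = - R_mu (- f)] ([Lint_qint]) are read off from the level sets.
Linearity on the functions [phi \o u] with [phi] non-decreasing ([qint_Aplus]) is
less visible because [mu] is not a measure; but the superlevel sets of all these
functions are superlevel sets of [u], so that all the quasi-integrals are
integrals against the single Stieltjes measure of [u] ([qint_comp]).  Hence
[R_mu] belongs to the families of functionals of the theorem.

Conversely, the classes of functionals of the theorem share, after a reflection
[f |-> - f] in two of the cases, the properties collected in [layered], the main
one being [r f = r (min f c) + r (max (f - c) 0)].  Such a functional defines a
deficient topological measure ([mu_of_DTM]).  Cutting [f] into thin slices writes
[r f] as a sum of the values of [r] at functions which are trapped between the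
indicators of consecutive level sets; so [r f] has the same Riemann sums as
[R_mu f] ([layered_qint]).  Urysohn functions show that [mu] is recovered from
[R_mu] ([mu_of_qint]).  For compact [X], the values on all of [C(X)] follow from
those on nonnegative functions by adding constants. *)

(** * Riemann sums and layer cakes *)
Section Approximation.
Context (R : realType).
Implicit Types a b c s x y C : R.

Lemma le_approx x y C : (forall N : nat, x <= y + C / N.+1%:R) -> x <= y.
Proof.
move=> h; apply/ler_addgt0Pr => e e0.
pose N := Num.bound (C / e).
apply: le_trans (h N) _; rewrite lerD2l.
rewrite ler_pdivrMr ?ltr0Sn// mulrC -ler_pdivrMr//.
apply: le_trans (ler_norm _) _.
apply: (@le_trans _ _ N%:R); last by rewrite ler_nat.
have := archi_boundP (normr_ge0 (C / e)).
by rewrite /N /Num.bound normr_id => /ltW.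
Qed.

Lemma eq_approx x y C : (forall N : nat, `|x - y| <= C / N.+1%:R) -> x = y.
Proof.
move=> h; apply/le_anti/andP; split; apply: (@le_approx _ _ C) => N;
  have := h N; rewrite ler_norml; move: (C / _) => e; lra.
Qed.

Definition mesh a b (N : nat) := (b - a) / N.+1%:R.
Definition node a b N (i : nat) := a + i%:R * mesh a b N.

Lemma mesh_ge0 a b N : a <= b -> 0 <= mesh a b N.
Proof. by move=> ab; rewrite divr_ge0 ?subr_ge0. Qed.

Lemma node0 a b N : node a b N 0 = a.
Proof. by rewrite /node mul0r addr0. Qed.

Lemma nodeS a b N i : node a b N i.+1 = node a b N i + mesh a b N.
Proof. by rewrite /node -addrA -[X in _ + (_ + X)]mul1r -mulrDl natr1. Qed.

Lemma node_last a b N : node a b N N.+1 = b.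
Proof. by rewrite /node /mesh mulrC divfK ?pnatr_eq0// addrC subrK. Qed.

Lemma mesh_sum a b N : \sum_(i < N.+1) mesh a b N = b - a.
Proof.
by rewrite sumr_const card_ord /mesh -[_ *+ _]mulr_natr divfK ?pnatr_eq0.
Qed.

(** Each step lies between two consecutive increments of [Num.min s] along the nodes,
and these increments telescope. *)
Lemma staircase a b N s : a <= s <= b ->
  s <= a + \sum_(i < N.+1) mesh a b N * (node a b N i < s)%R%:R
    <= s + mesh a b N.
Proof.
move=> /andP[a_s sb]; have m0 := mesh_ge0 N (le_trans a_s sb).
pose nd := node a b N; pose m := mesh a b N.
rewrite -(big_mkord xpredT (fun i => m * (nd i < s)%R%:R)).
apply/andP; split.
  have e : a + \sum_(0 <= i < N.+1) (Num.min s (nd i.+1) - Num.min s (nd i)) = s.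
    by rewrite telescope_sumr// /nd node0 node_last (min_idPl sb) (min_idPr a_s); ring.
  rewrite -[X in X <= _]e.
  rewrite lerD2l; apply: ler_sum => i _; rewrite /nd nodeS -/nd -/m.
  have [h|h] := ltP (nd i) s; rewrite ?mulr1 ?mulr0.
    by rewrite lerBlDl ge_min lexx orbT.
  by rewrite subr_le0 ge_min lexx.
have h0 : a - m <= s by rewrite lerBlDr; apply: le_trans a_s _; rewrite lerDl.
apply: (@le_trans _ _ (a + \sum_(0 <= i < N.+1)
    (Num.min s (nd i.+1 - m) - Num.min s (nd i - m)))).
  rewrite lerD2l; apply: ler_sum => i _; rewrite /nd nodeS -/nd -/m addrK.
  have [h|h] := ltP (nd i) s; rewrite ?mulr1 ?mulr0.
    rewrite (min_idPr _); last first.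
      by rewrite lerBlDr; apply: le_trans (ltW h) _; rewrite lerDl.
    by rewrite opprB addrC subrK.
  by rewrite subr_ge0 ge_min lexx.
rewrite telescope_sumr// /nd node0 node_last -/m (min_idPr h0) opprB.
have -> : a + (Num.min s (b - m) + (m - a)) = Num.min s (b - m) + m by ring.
by rewrite lerD2r ge_min lexx.
Qed.

(** Integrals are compared only through these sums, never by a change of variables. *)
Definition riem (G : R -> R) a b N :=
  \sum_(i < N.+1) mesh a b N * G (node a b N i).

End Approximation.

Section LayerCake.
Context d (T : measurableType d) (R : realType).
Variable m : {measure set T -> \bar R}.
Hypothesis mfin : (m setT < +oo)%E.

Lemma bounded_integrable (f : T -> R) (a b : R) : measurable_fun setT f ->
  (forall x, a <= f x <= b) -> m.-integrable setT (EFin \o f).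
Proof.
move=> mf fab; apply: measurable_bounded_integrable => //.
exists (`|a| + `|b|); split; first exact: num_real.
move=> M hM x _; apply: le_trans (ltW hM).
have /andP[h1 h2] := fab x; rewrite ler_norml.
have := ler_norm b; have := ler_norm (- a); rewrite normrN.
have := normr_ge0 a; have := normr_ge0 b; lra.
Qed.

Lemma Rintegral_step (A : nat -> set T) (c a : R) n :
  (forall i, measurable (A i)) ->
  m.-integrable setT (EFin \o (fun x => a + \sum_(i < n) c * \1_(A i) x)) /\
  \int[m]_x (a + \sum_(i < n) c * \1_(A i) x) =
  a * fine (m setT) + \sum_(i < n) c * fine (m (A i)).
Proof.
move=> mA; elim: n => [|n [IHi IHe]].
  under eq_fun do rewrite big_ord0 addr0; rewrite big_ord0 addr0; split.
    by apply: (@bounded_integrable (cst a) a a) => // x; rewrite lexx.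
  by rewrite Rintegral_cst.
have mi : measurable_fun setT (\1_(A n) : T -> R) by exact: measurable_indic.
have ii : m.-integrable setT (EFin \o (\1_(A n) : T -> R)).
  by apply: (@bounded_integrable _ 0 1) => // x; rewrite indicE;
    case: (_ \in _); rewrite ?lexx ler01.
have ic : m.-integrable setT (EFin \o (fun x => c * \1_(A n) x)).
  have := integrableZl measurableT c ii.
  by apply: eq_integrable => // x _ /=; rewrite EFinM.
split.
  have := integrableD measurableT IHi ic; apply: eq_integrable => // x _ /=.
  by rewrite big_ord_recr/= addrA EFinD.
under eq_Rintegral do rewrite big_ord_recr/= addrA.
rewrite RintegralD// IHe RintegralZl// big_ord_recr/= addrA; congr (_ + _ * _).
by rewrite /Rintegral integral_indic// setIT.
Qed.

(** Integrating [staircase] pointwise: up to one mesh, the integral of a bounded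
function depends only on the measures of its open superlevel sets. *)
Lemma layer_cake (phi : T -> R) (a b : R) N : measurable_fun setT phi ->
  (forall x, a <= phi x <= b) ->
  a * fine (m setT) + riem (fun t => fine (m [set x | t < phi x])) a b N
    - mesh a b N * fine (m setT) <=
  \int[m]_x phi x <=
  a * fine (m setT) + riem (fun t => fine (m [set x | t < phi x])) a b N.
Proof.
move=> mphi hphi.
pose A i := [set x | node a b N i < phi x].
have mA i : measurable (A i).
  have -> : A i = setT `&` phi @^-1` `]node a b N i, +oo[%classic.
    by apply/seteqP; split => x /=; rewrite in_itv/= andbT // => -[].
  by apply: mphi => //; exact: measurable_itv.
have [iS eS] := Rintegral_step (mesh a b N) a N.+1 mA.
have iphi : m.-integrable setT (EFin \o phi) by exact: bounded_integrable hphi.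
rewrite /riem -eS; set S := fun x => a + _ in iS *.
have hS x : phi x <= S x <= phi x + mesh a b N.
  have := staircase N (hphi x); rewrite /S /A; congr (_ <= a + _ <= _);
  by apply: eq_bigr => i _; rewrite indicE; congr (_ * _%:R);
  congr nat_of_bool; apply/idP/idP; rewrite inE.
have imesh : m.-integrable setT (EFin \o cst (mesh a b N)).
  by apply: (@bounded_integrable _ (mesh a b N) (mesh a b N)) => // x;
    rewrite lexx.
apply/andP; split; last first.
  by apply: le_Rintegral => // x _; have /andP[] := hS x.
rewrite lerBlDr -[X in _ + X]Rintegral_cst// -RintegralD//.
apply: le_Rintegral => //; last by move=> x _; have /andP[] := hS x.
by have := integrableD measurableT iphi imesh;
  apply: eq_integrable => // x _ /=.
Qed.

End LayerCake.

(** * Stieltjes integral of the identity *)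
Section StieltjesRiemann.
Context (R : realType) (F : R -> R) (ndF : {homo F : s t / s <= t}).
Local Notation G := (right_lim ndF).
Local Notation m := (ls_measure ndF).

Lemma right_lim_ge t : F t <= G t.
Proof. by apply: lb_le_inf; [exact: right_lim_ne|exact: right_lim_lb]. Qed.

Lemma ls_measure_itvoc s t : s <= t -> m `]s, t]%classic = (G t - G s)%:E.
Proof.
move=> st; rewrite /ls_measure /lebesgue_stieltjes_measure /measure_extension.
by rewrite measurable_mu_extE/= ?wlength_itv_bnd//; exact: is_ocitv.
Qed.

Variables (A B a b : R).
Hypotheses (ab : a <= b) (FA : forall t, t < a -> F t = A)
  (FB : forall t, b <= t -> F t = B).

Lemma right_limA t : t < a -> G t = A.
Proof.
move=> ta; apply/le_anti/andP; split; last by rewrite -(FA ta) right_lim_ge.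
have [ts sa] := midf_lt ta.
by apply: le_trans (right_lim_le ndF ts) _; rewrite FA.
Qed.

Lemma right_limB t : b <= t -> G t = B.
Proof.
move=> bt; apply/le_anti/andP; split; last by rewrite -(FB bt) right_lim_ge.
have t1 : t < t + 1 by rewrite ltrDl.
by apply: le_trans (right_lim_le ndF t1) _; rewrite FB// ltW// (le_lt_trans bt).
Qed.

Lemma leAB : A <= B.
Proof.
have -> : A = F (a - 1) by rewrite FA// ltrBlDr ltrDl.
by rewrite -(FB (lexx b)); apply: ndF; rewrite lerBlDr (le_trans ab)// lerDl.
Qed.

(** The exhausting intervals must end strictly before [a], since [F] may jump at
[a]. *)
Lemma ls_measure_left0 : m `]-oo, a[%classic = 0%E.
Proof.
have := @negligible_bigcup _ _ _ m
  (fun n => `]a - n.+1%:R, a - n.+1%:R^-1]%classic).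
have -> : \bigcup_n `]a - n.+1%:R, a - n.+1%:R^-1]%classic = `]-oo, a[%classic :> set R.
  apply/seteqP; split => [x [n _ /=]|x /=]; rewrite !in_itv/=.
    by case/andP => _ /le_lt_trans; apply; rewrite ltrBlDr ltrDl.
  move=> xa; pose n := maxn (Num.bound (a - x)) (Num.bound (a - x)^-1).
  have ax : 0 < a - x by rewrite subr_gt0.
  exists n => //=; rewrite in_itv/=; apply/andP; split.
    rewrite ltrBlDr -ltrBlDl; apply: lt_le_trans (archi_boundP (ltW ax)) _.
    by rewrite ler_nat /n leqW// leq_maxl.
  rewrite lerBrDr -lerBrDl -[X in _ <= X]invrK lef_pV2 ?posrE ?invr_gt0//.
  apply: le_trans (ltW (archi_boundP _)) _; first by rewrite invr_ge0 ltW.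
  by rewrite ler_nat /n leqW// leq_maxr.
move=> /(_ _)/negligibleP; apply; first exact: measurable_itv.
move=> n; apply/negligibleP; first exact: measurable_itv.
have n1 : a - n.+1%:R <= a - n.+1%:R^-1.
  by rewrite lerD2l lerN2 (le_trans (y := 1))// ?invf_le1 ?ler1n ?ltr0n.
rewrite [LHS]ls_measure_itvoc// !right_limA ?subrr// ltrBlDr ltrDl ?ltr0n ?invr_gt0//.
Qed.

Lemma ls_measure_right0 t : b <= t -> m `]t, +oo[%classic = 0%E.
Proof.
move=> bt; have := @negligible_bigcup _ _ _ m (fun n => `]t, t + n%:R]%classic).
have -> : \bigcup_n `]t, t + n%:R]%classic = `]t, +oo[%classic :> set R.
  apply/seteqP; split => [x [n _ /=]|x /=]; rewrite !in_itv/= ?andbT.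
    by case/andP.
  move=> tx; exists (Num.bound (x - t)) => //=; rewrite in_itv/= tx/= -lerBlDl.
  by apply: ltW; apply: archi_boundP; rewrite subr_ge0 ltW.
move=> /(_ _)/negligibleP; apply; first exact: measurable_itv.
move=> n; apply/negligibleP; first exact: measurable_itv.
have tn : t <= t + n%:R by rewrite lerDl.
by rewrite [LHS]ls_measure_itvoc// !right_limB ?subrr// (le_trans bt).
Qed.

Lemma ls_measure_ray t : m `]t, +oo[%classic = (B - G t)%:E.
Proof.
have [bt|tb] := leP b t;
  first by rewrite ls_measure_right0// right_limB// subrr.
have -> : `]t, +oo[%classic = `]t, b] `|` `]b, +oo[ :> set R.
  by rewrite -itv_bndbnd_setU// bnd_simp ltW.
rewrite measureU//=.
  rewrite [X in (_ + X)%E]ls_measure_right0// adde0 [LHS]ls_measure_itvoc ?(ltW tb)//.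
  by rewrite right_limB.
apply/seteqP; split => // x []; rewrite /= !in_itv/= andbT => /andP[_ xb].
by rewrite ltNge xb.
Qed.

Lemma ls_measure_setT : m setT = (B - A)%:E.
Proof.
have -> : [set: R] = `]-oo, a - 1] `|` `]a - 1, +oo[.
  by rewrite -itv_bndbnd_setU// set_itvE.
rewrite measureU//=.
  rewrite [X in (_ + X)%E]ls_measure_ray right_limA ?ltrBlDr ?ltrDl//.
  rewrite [X in (X + _)%E](_ : _ = 0%E) ?add0e//.
  apply: (subset_measure0 _ _ _ ls_measure_left0) => //.
  by move=> x /=; rewrite !in_itv/= => /le_lt_trans; apply;
    rewrite ltrBlDr ltrDl.
apply/seteqP; split => // x []; rewrite /= !in_itv/= andbT => xb.
by rewrite ltNge xb.
Qed.

Lemma ls_measure_lty : (m setT < +oo)%E.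
Proof. by rewrite ls_measure_setT ltry. Qed.

Let clamp t := Num.max a (Num.min t b).

Let clamp_itv t : a <= clamp t <= b.
Proof. by rewrite /clamp le_max lexx/= ge_max ab ge_min lexx orbT. Qed.

Let measurable_clamp : measurable_fun setT clamp.
Proof.
by apply: measurable_maxr => //; exact: measurable_minr.
Qed.

(** The measure lives on [[a, b]]; clamping makes the integrand bounded. *)
Lemma ls_integral_clamp : (\int[m]_t t%:E)%E = (\int[m]_t (clamp t)%:E)%E.
Proof.
apply: ae_eq_integral => //.
- exact/measurable_EFinP.
exists (`]-oo, a[ `|` `]b, +oo[); split.
- by apply: measurableU; exact: measurable_itv.
- by rewrite measureU0//; [exact: ls_measure_left0|exact: ls_measure_right0].
- move=> t /=; apply: contra_notP; rewrite !in_itv/= andbT.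
  move=> /not_orP[/negP + /negP]; rewrite -!leNgt => a_t tb _.
  by rewrite /clamp (min_idPl tb) (max_idPr a_t).
Qed.

(** The measure of a ray starting at a node involves the right limit of [F] there,
which lies between the values of [F] at this node and at the next one.  This
costs one mesh in addition to that of [layer_cake], whence the factor 2. *)
Lemma ls_riemann N : (\int[m]_t t%:E)%E \is a fin_num /\
  a * (B - A) + riem (fun t => B - F t) a b N - 2 * (mesh a b N * (B - A))
  <= fine ((\int[m]_t t%:E)%E) <= a * (B - A) + riem (fun t => B - F t) a b N.
Proof.
split.
  rewrite ls_integral_clamp; apply: integrable_fin_num => //.
  exact: (bounded_integrable ls_measure_lty measurable_clamp clamp_itv).
rewrite ls_integral_clamp.
have := layer_cake ls_measure_lty N measurable_clamp clamp_itv.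
rewrite (_ : fine (_ [set: _]) = B - A);
  last by rewrite [X in fine X]ls_measure_setT.
rewrite -/(Rintegral _ _ _); set I := Rintegral _ _ _.
have m0 := mesh_ge0 N ab.
have [m00|mn0] := eqVneq (mesh a b N) 0.
  by rewrite /riem m00; under eq_bigr do rewrite mul0r;
    under [in X in _ -> X]eq_bigr do rewrite mul0r; rewrite !mul0r mulr0.
have mgt : 0 < mesh a b N by rewrite lt_def mn0.
rewrite (_ : riem _ a b N = riem (fun t => B - G t) a b N); last first.
  apply: eq_bigr => i _; congr (_ * _).
  rewrite (_ : [set x | _] = `]node a b N i, +oo[%classic); last first.
    apply/seteqP; split => x /=; rewrite in_itv/= andbT /clamp lt_max lt_min.
      by case/orP => [|/andP[]//]; rewrite ltNge lerDl mulr_ge0.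
    move=> ->/=; apply/orP; right; have : node a b N i < node a b N N.+1;
      last by rewrite node_last.
    by rewrite /node ltrD2l ltr_pM2r// ltr_nat.
  by rewrite [X in fine X]ls_measure_ray.
set D := B - A; have D0 : 0 <= D by rewrite subr_ge0 leAB.
move=> /andP[h1 h2]; apply/andP; split; last first.
  apply: le_trans h2 _; rewrite lerD2l; apply: ler_sum => i _.
  by rewrite ler_pM2l// lerD2l lerN2 right_lim_ge.
apply: le_trans h1.
suff : riem (fun t => B - F t) a b N - mesh a b N * D <= riem (fun t => B - G t) a b N.
  by move: (mesh _ _ _ * D) (riem _ _ _ _) (riem _ _ _ _) (a * D) => x y z t;
    lra.
rewrite lerBlDr -lerBlDl /riem -sumrB.
apply: (@le_trans _ _ (\sum_(0 <= i < N.+1)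
    mesh a b N * (F (node a b N i.+1) - F (node a b N i)))).
  rewrite big_mkord; apply: ler_sum => i _; rewrite -mulrBr ler_pM2l//.
  have : G (node a b N i) <= F (node a b N i.+1).
    by apply: right_lim_le; rewrite nodeS ltrDl.
  by move: (G _) (F _) (F _) => x y z; lra.
rewrite -mulr_sumr telescope_sumr// ler_pM2l// node_last node0 FB//.
rewrite lerD2l lerN2 -(FA (_ : a - 1 < a)) ?ltrBlDr ?ltrDl//; apply: ndF.
by rewrite lerBlDr lerDl.
Qed.

End StieltjesRiemann.

(** * Continuous functions on a locally compact space *)
Section ContinuousFunctions.
Context (X : topologicalType) (R : realType).
Implicit Types f g : continuousType X R.

Lemma fun_cts f : continuous f.
Proof. exact: cts_fun. Qed.

Lemma cts_ext f g : (forall x, f x = g x) -> f = g.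
Proof. by move=> fg; apply/continuousEP. Qed.

Lemma continuous_oppc f : continuous (fun x => - f x).
Proof. by move=> x; apply: cvgN; exact: fun_cts. Qed.
Definition oppc f : continuousType X R := mkcts (@continuous_oppc f).

Lemma continuous_minc f c : continuous (fun x => Num.min (f x) c).
Proof. by move=> x; apply: continuous_min; [exact: fun_cts|exact: cvg_cst]. Qed.
Definition minc f c : continuousType X R := mkcts (@continuous_minc f c).

Lemma continuous_shiftc f c : continuous (fun x => f x + c).
Proof. by move=> x; apply: cvgD; [exact: fun_cts|exact: cvg_cst]. Qed.
Definition shiftc f c : continuousType X R := mkcts (@continuous_shiftc f c).

Lemma continuous_excess f c : continuous (fun x => Num.max (f x - c) 0).
Proof.
move=> x; apply: (@continuous_max R _ (shiftc f (- c)) (cst 0)).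
  exact: fun_cts.
exact: cvg_cst.
Qed.
Definition excess f c : continuousType X R := mkcts (@continuous_excess f c).

Lemma continuous_scalec f c : continuous (fun x => c * f x).
Proof. by move=> x; apply: cvgM; [exact: cvg_cst|exact: fun_cts]. Qed.
Definition scalec f c : continuousType X R := mkcts (@continuous_scalec f c).

Lemma continuous_addc f g : continuous (fun x => f x + g x).
Proof. by move=> x; apply: cvgD; exact: fun_cts. Qed.
Definition addc f g : continuousType X R := mkcts (@continuous_addc f g).

Lemma continuous_constc c : continuous (fun _ : X => c : R).
Proof. by move=> x; exact: cvg_cst. Qed.
Definition constc c : continuousType X R := mkcts (@continuous_constc c).

Lemma closed_fun_ge f c : closed [set x | c <= f x].
Proof.
apply: (@preimage_closed X R f [set y | c <= y]); last exact: closed_ge.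
by move=> x _; exact: fun_cts.
Qed.

Lemma closed_norm_ge f c : closed [set x | c <= `|f x|].
Proof.
have cf : continuous (fun x => `|f x|) by move=> x; apply: cvg_norm;
  exact: fun_cts.
exact: (preimage_closed (in1W cf) (@closed_ge _ c)).
Qed.

Lemma C0_bounded f : C0 X R f -> exists2 b, 0 < b & forall x, `|f x| <= b.
Proof.
move=> /(_ 1 ltr01) cK.
have cf : {within [set x | 1 <= `|f x|], continuous (fun x => `|f x|)}.
  by apply: continuous_subspaceT => x; apply: cvg_norm; exact: fun_cts.
have [K0|/set0P K0] := eqVneq [set x | 1 <= `|f x|] set0.
  exists 1 => // x; rewrite leNgt; apply/negP => /ltW h.
  by have : set0 x by rewrite -K0.
have [c _ hc] := compact_EVT_max K0 cK cf.
exists (Num.max 1 `|f c|); first by rewrite lt_max ltr01.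
move=> x; rewrite le_max; have [h|/ltW ->//] := leP 1 `|f x|.
by rewrite hc ?orbT// inE.
Qed.

Lemma C0p_bounded f : C0p X R f -> exists2 b, 0 < b & forall x, 0 <= f x <= b.
Proof.
move=> [/C0_bounded[b b0 hb] f0]; exists b => // x.
by rewrite f0 (le_trans (ler_norm _)).
Qed.

Lemma C0_sub f g : C0 X R f -> (forall x, `|g x| <= `|f x|) -> C0 X R g.
Proof.
move=> hf gf e e0; apply: subclosed_compact (hf e e0) _;
  first exact: closed_norm_ge.
by move=> x /= h; exact: le_trans h (gf x).
Qed.

Lemma C0_opp f : C0 X R f -> C0 X R (oppc f).
Proof. by move=> hf; apply: C0_sub hf _ => x /=; rewrite normrN. Qed.

Lemma Cc_C0 f : Cc X R f -> C0 X R f.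
Proof.
move=> cf e e0; apply: subclosed_compact cf _; first exact: closed_norm_ge.
move=> x /= h; apply: subset_closure => /=.
by apply/eqP => fx0; move: h; rewrite fx0 normr0 leNgt e0.
Qed.

Lemma compact_C0 f : compact [set: X] -> C0 X R f.
Proof. by move=> cX e e0; apply: subclosed_compact cX _ => //;
  exact: closed_norm_ge. Qed.

Lemma C0_scale f c : C0 X R f -> C0 X R (scalec f c).
Proof.
move=> hf e e0; have [->|c0] := eqVneq c 0.
  rewrite (_ : [set _ | _] = set0); first exact: compact0.
  by apply/seteqP; split => // x /=;
    rewrite /scalec /= /mkcts mul0r normr0 leNgt e0.
have nc : 0 < `|c| by rewrite normr_gt0.
have := hf (e / `|c|) (divr_gt0 e0 nc); congr compact.
by apply/seteqP; split => x /=; rewrite normrM ler_pdivrMr// mulrC.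
Qed.

Lemma C0_add f g : C0 X R f -> C0 X R g -> C0 X R (addc f g).
Proof.
move=> hf hg e e0; have e2 : 0 < e / 2 by rewrite divr_gt0.
apply: subclosed_compact (compactU (hf _ e2) (hg _ e2)) _;
  first exact: closed_norm_ge.
move=> x /= h; have [?|h1] := leP (e / 2) `|f x|; first by left.
right; have := ler_normD (f x) (g x); move: (`|f x|) (`|g x|) h h1 => p q; lra.
Qed.

End ContinuousFunctions.

Section Urysohn.
Context (X : topologicalType) (R : realType).
Hypotheses (lcX : locally_compact [set: X]) (hX : hausdorff_space X).

(** Urysohn's lemma in the one-point compactification gives [h] equal to 1 on [K] and
to 0 off [U].  The support of [max (2 h - 1) 0] lies in [{h >= 1/2}], a closed set
that misses a neighborhood of the point at infinity, hence is compact. *)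
Lemma compact_open_separation (K U : set X) : compact K -> open U -> K `<=` U ->
  exists f : continuousType X R,
    [/\ Cc X R f, forall x, 0 <= f x <= 1, forall x, K x -> f x = 1 &
        supp f `<=` U].
Proof.
move=> cK oU KU; pose O := one_point_compactification X.
pose so : X -> O := Some.
have hO : hausdorff_space O by exact: one_point_compactification_hausdorff.
have nO : normal_space O by apply: compact_normal => //;
  exact: one_point_compactification_compact.
have clK : closed (so @` K).
  apply: compact_closed => //; apply: continuous_compact => //.
  apply: continuous_subspaceT;
    exact: one_point_compactification_some_continuous.
have clU : closed (~` (so @` U)).
  by apply: open_closedC; exact: one_point_compactification_open_some.
have KU0 : ~` (so @` U) `&` so @` K = set0.
  by apply/seteqP; split => // y [h [x Kx xy]]; apply: h; exists x => //;
    exact: KU.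
have /(@normal_separatorP R) sep := nO.
have /(@uniform_separatorP _ R)[f [cf f01 f0 f1]] := sep _ _ clU clK KU0.
have f0E y : ~ (so @` U) y -> f y = 0 by move=> h; apply: f0; exists y.
have f1E x : K x -> f (so x) = 1 by move=> h; apply: f1; exists (so x) => //;
  exists x.
have f01E y : 0 <= f y <= 1.
  by have /= := f01 (f y); rewrite in_itv/=; apply; exists y.
have cfs : continuous (f \o so).
  move=> x; apply: continuous_comp; last exact: cf.
  exact: one_point_compactification_some_continuous.
pose h : continuousType X R := mkcts cfs.
pose g := excess (scalec h 2) 1.
have cl : closed [set x | 1 <= scalec h 2 x] by exact: closed_fun_ge.
have sg : supp g `<=` [set x | 1 <= scalec h 2 x].
  rewrite [X in _ `<=` X](closure_id _).1//; apply: closureS => x /=.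
  apply: contra_neqT; rewrite -ltNge => /ltW hx.
  by apply/max_idPr; rewrite subr_le0.
exists g; split.
- have : f y @[y --> (None : O)] --> f None by exact: cf.
  rewrite f0E; last by case.
  move=> /cvgr_lt/(_ 2^-1); rewrite invr_gt0 ltr0n => /(_ isT) [W [cW clW] WE].
  apply: subclosed_compact (_ : closed (supp g)) cW _;
    first exact: closed_closure.
  move=> x /sg /= hx; apply: contrapT => Wx.
  have /= : f (so x) < 2^-1 by apply: WE; left; exists x.
  by rewrite ltNge -(ler_pM2l (ltr0n R 2)) divff ?pnatr_eq0//; move/negP; apply.
- move=> x /=; rewrite /g /= /mkcts le_max lexx orbT ge_max ler01 andbT.
  by have /andP[_] := f01E (so x); rewrite /=; move: (f _) => t; lra.
- move=> x Kx; rewrite /g /= /mkcts /= f1E//; apply/eqP; rewrite eq_le.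
  rewrite ge_max le_max; apply/andP; split; first by lra.
  by apply/orP; left; lra.
- move=> x /sg /= hx; apply: contrapT => Ux; move: hx; rewrite /= /mkcts /= f0E.
    by rewrite mulr0 ler10.
  by case=> y Uy [yx]; apply: Ux; rewrite -yx.
Qed.
End Urysohn.

(** * Deficient topological measures on sets and level sets *)
Definition elt (T : Type) (A : set T) (x : T) (h : A x) : A :=
  exist _ x (mem_set h).

Section DTMValues.
Context (X : topologicalType) (R : realType).
Hypothesis hX : hausdorff_space X.

(** Total on sets, so that openness proofs do not appear in the terms; the value off
the closed and open sets is a dummy. *)
Definition dval (mu : DTM X R) (A : set X) : R :=
  if pselect (closed_or_open X A) is left h then fine (\val mu (elt h))
  else 0.

Variable mu : DTM X R.
Local Notation d := (dval mu).

Lemma dvalE (A : closed_or_open X) : d (\val A) = fine (\val mu A).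
Proof.
rewrite /dval; case: pselect => [h|/(_ (set_valP A))//].
by congr (fine (\val mu _)); exact: val_inj.
Qed.

Lemma DTM_fin (A : closed_or_open X) : \val mu A \is a fin_num.
Proof.
case: (set_valP mu) => -[mu0 _ _ out] muT.
have [clA|oA] := set_valP A; last first.
  by rewrite (_ : A = oset oA); [exact: DTM_open_fin|exact: val_inj].
rewrite ge0_fin_numE//; apply: le_lt_trans muT; rewrite out//.
by apply: ereal_inf_lbound; exists (oset openT) => //; split => //;
  exact: openT.
Qed.

Lemma DTM_dval (A : closed_or_open X) : \val mu A = (d (\val A))%:E.
Proof. by rewrite dvalE fineK// DTM_fin. Qed.

Lemma dval_ge0 A : 0 <= d A.
Proof.
case: (set_valP mu) => -[mu0 _ _ _] _.
by rewrite /dval; case: pselect => // h; rewrite fine_ge0.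
Qed.

Lemma dval_le A U : closed A \/ open A -> open U -> A `<=` U -> d A <= d U.
Proof.
move=> hA oU AU; pose A' : closed_or_open X := elt (hA : closed_or_open X A).
rewrite -[A]/(\val A') -[U]/(\val (oset oU)).
rewrite -lee_fin -!DTM_dval.
have [clA|oA] := hA; last first.
  rewrite (_ : A' = oset oA); last exact: val_inj.
  exact: DTM_le_open.
case: (set_valP mu) => -[_ _ _ out] _; rewrite out//.
by apply: ereal_inf_lbound; exists (oset oU).
Qed.

(** Inner regularity as an elimination rule for upper bounds. *)
Lemma dval_inner U x : open U ->
  (forall K, compact K -> K `<=` U -> d K <= x) -> d U <= x.
Proof.
move=> oU h; rewrite -[U]/(\val (oset oU)) -lee_fin -!DTM_dval.
case: (set_valP mu) => -[_ _ inn _] _; rewrite inn//.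
by apply: ge_ereal_sup => _ [K [cK KU] <-]; rewrite DTM_dval lee_fin; exact: h.
Qed.

Lemma dval_addK K1 K2 : compact K1 -> compact K2 -> K1 `&` K2 = set0 ->
  d (K1 `|` K2) = d K1 + d K2.
Proof.
move=> c1 c2 K120.
have h1 : closed_or_open X K1 by left; exact: compact_closed.
have h2 : closed_or_open X K2 by left; exact: compact_closed.
have h3 : closed_or_open X (K1 `|` K2).
  by left; apply: compact_closed => //; exact: compactU.
case: (set_valP mu) => -[_ add _ _] _.
have := add (elt h1) (elt h2) (elt h3) c1 c2 K120 erefl.
by rewrite !DTM_dval -EFinD/= => -[].
Qed.

Lemma dval0 : d set0 = 0.
Proof.
have := dval_addK (@compact0 X) (@compact0 X) (setI0 _).
by rewrite setU0 => /eqP; rewrite -subr_eq subrr => /eqP.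
Qed.

(** A compact subset of [U `|` V] meets [U] in a compact set, since this part is also
the complement of [V] in it; so additivity passes from compact to open sets by
inner regularity. *)
Lemma dval_addO U V : open U -> open V -> U `&` V = set0 ->
  d (U `|` V) = d U + d V.
Proof.
move=> oU oV UV0; have oUV := openU oU oV.
apply/le_anti/andP; split.
  apply: dval_inner => // K cK KUV.
  have clK := compact_closed hX cK.
  have KE A B : K `<=` A `|` B -> open B -> A `&` B = set0 -> K `&` A = K `&` ~` B.
    move=> KAB oB AB; apply/seteqP; split => x [Kx h]; split => //.
      by move=> Bx; have : set0 x by rewrite -AB.
    by have [//|Bx] := KAB _ Kx; case: h.
  have cc A B : K `<=` A `|` B -> open B -> A `&` B = set0 -> compact (K `&` A).
    move=> KAB oB AB; rewrite (KE _ _ KAB oB AB).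
    by apply: compact_closedI => //; exact: open_closedC.
  have cU := cc _ _ KUV oV UV0.
  have cV : compact (K `&` V) by apply: (cc V U) => //; rewrite 1?setUC// setIC.
  have -> : K = (K `&` U) `|` (K `&` V) by rewrite -setIUr setIidl.
  rewrite dval_addK//; last by rewrite setIACA UV0 setI0.
  by apply: lerD; apply: dval_le => //; left; exact: compact_closed.
rewrite -lerBrDr; apply: dval_inner => // K cK KU.
rewrite lerBrDr addrC -lerBrDr; apply: dval_inner => // L cL LV.
rewrite lerBrDr addrC -dval_addK//; last first.
  by apply/seteqP; split => // x [/KU Ux /LV Vx]; rewrite -UV0.
apply: dval_le => //; last exact: setUSS.
by left; apply: compact_closed => //; exact: compactU.
Qed.

Implicit Types f g : continuousType X R.

Lemma R1E f t : R1 mu f t = d (f @^-1` `]t, +oo[%classic).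
Proof. by rewrite /R1 -dvalE. Qed.

Lemma L1E f t : L1 mu f t = d (f @^-1` `]-oo, t[%classic).
Proof. by rewrite /L1 -dvalE. Qed.

Lemma R1_ge0 f t : 0 <= R1 mu f t.
Proof. by rewrite R1E dval_ge0. Qed.

Lemma R1_leT f t : R1 mu f t <= d setT.
Proof.
by rewrite R1E; apply: dval_le => //; [right; exact: open_gt_fun|exact: openT].
Qed.

Lemma R1_homo f g t : (forall x, t < f x -> t < g x) -> R1 mu f t <= R1 mu g t.
Proof.
move=> fg; rewrite !R1E; apply: dval_le; [right| |]; try exact: open_gt_fun.
by move=> x /=; rewrite !in_itv/= !andbT; exact: fg.
Qed.

Lemma R1_T f t : (forall x, t < f x) -> R1 mu f t = d setT.
Proof.
move=> h; rewrite R1E; congr d; apply/seteqP; split => // x _ /=.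
by rewrite in_itv/= h.
Qed.

Lemma R1_0 f t : (forall x, f x <= t) -> R1 mu f t = 0.
Proof.
move=> h; rewrite R1E -[RHS]dval0; congr d; apply/seteqP; split => // x /=.
by rewrite in_itv/= andbT ltNge h.
Qed.

Lemma L1_R1 f t : L1 mu f t = R1 mu (oppc f) (- t).
Proof.
rewrite R1E L1E; congr d; apply/seteqP; split => x /=;
  by rewrite !in_itv/= !andbT ltrN2.
Qed.

(** [R_mu f] as a real number; used for bounded [f], where the integral is finite. *)
Definition qint f : R := fine (Defs.Rint mu f).

Lemma Rint_approx f a b N : (forall x, a <= f x <= b) -> a <= b ->
  Defs.Rint mu f = (qint f)%:E /\
  a * d setT + riem (R1 mu f) a b N - 2 * (mesh a b N * d setT) <=
  qint f <= a * d setT + riem (R1 mu f) a b N.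
Proof.
move=> fab ab.
have FA t : t < a -> - R1 mu f t = - d setT.
  by move=> ta; rewrite R1_T// => x; apply: lt_le_trans ta _;
    case/andP: (fab x).
have FB t : b <= t -> - R1 mu f t = 0.
  move=> bt; rewrite R1_0 ?oppr0// => x; apply: le_trans bt;
    by case/andP: (fab x).
have [fin] := ls_riemann (R1_nonincreasing mu f) ab FA FB N.
rewrite sub0r opprK (_ : riem _ a b N = riem (R1 mu f) a b N); last first.
  by apply: eq_bigr => i _; rewrite sub0r opprK.
by rewrite -/(Defs.Rint mu f) -/(qint f) => ->; rewrite /qint fineK.
Qed.

End DTMValues.

(** * The quasi-integral through Riemann sums *)
Section RiemannSums.
Context (R : realType).
Implicit Types (G H : R -> R) (a b c : R).

Lemma riem_le G H a b N : a <= b -> (forall t, a <= t < b -> G t <= H t) ->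
  riem G a b N <= riem H a b N.
Proof.
move=> ab GH; have m0 := mesh_ge0 N ab.
have [m00|mn0] := eqVneq (mesh a b N) 0.
  by rewrite /riem !big1// => i _; rewrite m00 mul0r.
have mgt : 0 < mesh a b N by rewrite lt_def mn0.
apply: ler_sum => i _; rewrite ler_pM2l//; apply: GH; apply/andP; split.
  by rewrite /node lerDl mulr_ge0.
have : node a b N i < node a b N N.+1; last by rewrite node_last.
by rewrite /node ltrD2l ltr_pM2r// ltr_nat.
Qed.

Lemma riem_cst c a b N : riem (fun=> c) a b N = c * (b - a).
Proof. by rewrite /riem -mulr_suml mesh_sum mulrC. Qed.

Lemma riem_add G H a b N :
  riem (fun t => G t + H t) a b N = riem G a b N + riem H a b N.
Proof. by rewrite /riem -big_split; apply: eq_bigr => i _; rewrite mulrDr. Qed.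

Lemma riem_opp G a b N : riem (fun t => - G t) a b N = - riem G a b N.
Proof. by rewrite /riem -sumrN; apply: eq_bigr => i _; rewrite mulrN. Qed.

(** The nodes of a symmetric interval are exchanged by reflection, up to a shift. *)
Lemma riem_reflect G b N : riem (fun t => G (- t)) (- b) b N =
  riem G (- b) b N + mesh (- b) b N * (G b - G (- b)).
Proof.
rewrite /riem -!mulr_sumr -mulrDr; congr (_ * _).
rewrite (reindex_inj rev_ord_inj)/=.
have -> : \sum_(i < N.+1) G (- node (- b) b N (N.+1 - i.+1)) =
          \sum_(0 <= i < N.+1) G (node (- b) b N i.+1).
  rewrite big_mkord; apply: eq_bigr => i _; congr G.
  rewrite subSS /node natrB; last by rewrite -ltnS.
  have h : N.+1%:R * mesh (- b) b N = b - - b.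
    by rewrite mulrC /mesh divfK ?pnatr_eq0.
  move: h; rewrite -!natr1; move: (mesh _ _ _) (N%:R) (i%:R); clear => m n j h.
  by apply/eqP; rewrite -subr_eq0; apply/eqP; move: h;
    rewrite !mulrDl ?mulNr ?mul1r; move: (n * m) (j * m); clear => p q; lra.
rewrite -(big_mkord xpredT (fun i => G (node (- b) b N i))).
have := telescope_sumr (fun i => G (node (- b) b N i)) (leq0n N.+1).
rewrite node_last node0 => <-; rewrite -big_split; apply: eq_bigr => i _ /=;
  ring.
Qed.

End RiemannSums.

Section DTMIntegral.
Context (X : topologicalType) (R : realType).
Hypothesis hX : hausdorff_space X.
Variable mu : DTM X R.
Local Notation d := (dval mu).
Local Notation qint := (qint mu).
Implicit Types f g h : continuousType X R.

Definition bounded_cts f := exists b, forall x, `|f x| <= b.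

Lemma bounded_cts_bound f : bounded_cts f ->
  exists2 b, 0 <= b & forall x, - b <= f x <= b.
Proof.
move=> [b hb]; exists (Num.max 0 b); first by rewrite le_max lexx.
by move=> x; rewrite -ler_norml le_max hb orbT.
Qed.

Lemma bounded_cts_common_bound f g : bounded_cts f -> bounded_cts g ->
  exists2 b, 0 <= b &
  forall x, - b <= f x <= b /\ - b <= g x <= b.
Proof.
move=> [b hb] [c hc]; exists (Num.max 0 (Num.max b c));
  first by rewrite le_max lexx.
by move=> x; rewrite -!ler_norml !le_max hb hc !orbT.
Qed.

Lemma bounded_cts_opp f : bounded_cts f -> bounded_cts (oppc f).
Proof. by move=> [b hb]; exists b => x; rewrite /= /mkcts normrN. Qed.

Lemma C0_bounded_cts f : C0 X R f -> bounded_cts f.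
Proof. by move=> /C0_bounded[b _ hb]; exists b. Qed.

Lemma qint_approx f a b N : (forall x, a <= f x <= b) -> a <= b ->
  `|qint f - (a * d setT + riem (R1 mu f) a b N)|
    <= 2 * ((b - a) * d setT) / N.+1%:R.
Proof.
move=> fab ab; have [_] := Rint_approx hX mu N fab ab.
have -> : 2 * ((b - a) * d setT) / N.+1%:R = 2 * (mesh a b N * d setT).
  by rewrite /mesh; ring.
have : 0 <= mesh a b N * d setT by rewrite mulr_ge0 ?mesh_ge0// dval_ge0.
rewrite ler_norml; move: (qint f) (mesh _ _ _ * _) (riem _ _ _ _) (a * _);
  clear => p e r s; lra.
Qed.

Lemma Rint_qint f : bounded_cts f -> Defs.Rint mu f = (qint f)%:E.
Proof.
move=> /bounded_cts_bound[b b0 hb].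
by have [] := Rint_approx hX mu 0 hb (le_trans (_ : - b <= 0) b0);
  rewrite ?oppr_le0.
Qed.

Lemma qint_homo f g : bounded_cts f -> bounded_cts g ->
  (forall x, f x <= g x) -> qint f <= qint g.
Proof.
move=> bf bg fg; have [b b0 hb] := bounded_cts_common_bound bf bg.
have bb : - b <= b by rewrite (le_trans (_ : _ <= 0))// oppr_le0.
apply: (@le_approx _ _ _ (2 * (2 * ((b - - b) * d setT)))) => N.
have h1 := qint_approx N (fun x => (hb x).1) bb.
have h2 := qint_approx N (fun x => (hb x).2) bb.
have h3 : riem (R1 mu f) (- b) b N <= riem (R1 mu g) (- b) b N.
  by apply: riem_le => // t _; apply: R1_homo => x tx;
    exact: lt_le_trans (fg x).
move: h1 h2 h3; rewrite !ler_norml -(mulrA 2 (2 * _)); move: (2 * _ / _) => e.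
move: (qint f) (qint g) (riem _ _ _ _) (riem _ _ _ _) (_ * d _);
  clear => p q r s t; lra.
Qed.

Lemma qint_ge f a : bounded_cts f -> (forall x, a <= f x) -> a * d setT <= qint f.
Proof.
move=> [b hb] fa; have fab x : a <= f x <= Num.max a b.
  by rewrite fa le_max (le_trans (ler_norm _) (hb x)) orbT.
have ab : a <= Num.max a b by rewrite le_max lexx.
apply: (@le_approx _ _ _ (2 * ((Num.max a b - a) * d setT))) => N.
have := qint_approx N fab ab.
have : 0 <= riem (R1 mu f) a (Num.max a b) N.
  by rewrite -[X in X <= _](mul0r (Num.max a b - a)) -(riem_cst 0 a _ N) riem_le// =>
    t _; exact: R1_ge0.
rewrite ler_norml; move: (qint f) (riem _ _ _ _) (_ / N.+1%:R) (a * d _);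
  clear => p r s t; lra.
Qed.

Lemma qint_le f b : bounded_cts f -> (forall x, f x <= b) -> qint f <= b * d setT.
Proof.
move=> [a ha] fb; have fab x : Num.min (- a) b <= f x <= b.
  by rewrite fb ge_min; have := ha x; rewrite ler_norml => /andP[->].
have ab : Num.min (- a) b <= b by rewrite ge_min lexx orbT.
move: fab ab; set a' := Num.min _ _ => fab ab.
apply: (@le_approx _ _ _ (2 * ((b - a') * d setT))) => N.
have := qint_approx N fab ab.
have : riem (R1 mu f) a' b N <= d setT * (b - a').
  by rewrite -(riem_cst (d setT) a' _ N) riem_le// => t _; exact: R1_leT.
rewrite ler_norml mulrBr ![d setT * _]mulrC.
move: (qint f) (riem _ _ _ _) (_ / N.+1%:R) (a' * d _) (b * d _);
  clear => p r s t u; lra.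
Qed.

Lemma qint_cst c f : (forall x, f x = c) -> qint f = c * d setT.
Proof.
move=> fc; have bf : bounded_cts f by exists `|c| => x; rewrite fc.
by apply/le_anti; rewrite qint_le ?qint_ge// => x; rewrite fc.
Qed.

(** The distribution of the zero function corrects the additivity of distributions at
negative levels, where the superlevel set of a nonnegative function is [X]. *)
Lemma qint_add f g h : bounded_cts f -> bounded_cts g -> bounded_cts h ->
  (forall t, R1 mu h t + R1 mu (constc X 0) t = R1 mu f t + R1 mu g t) ->
  qint h = qint f + qint g.
Proof.
move=> bf bg bh H; have z : qint (constc X 0) = 0 by rewrite (@qint_cst 0) ?mul0r.
rewrite -[LHS]addr0 -[X in _ + X = _]z.
have [b b0 hb] := bounded_cts_common_bound bf bg;
  have [c c0 hc] := bounded_cts_bound bh.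
pose e := Num.max b c; have bb : - e <= e.
  have : 0 <= e by rewrite le_max b0.
  by move=> ?; rewrite (le_trans (_ : _ <= 0))// oppr_le0.
have wid (p q : R) : p <= e -> - p <= q <= p -> - e <= q <= e.
  by move=> ? /andP[? ?]; apply/andP; split; [rewrite lerNl|];
    apply: le_trans (_ : p <= e); rewrite // lerNl.
have be : b <= e by rewrite le_max lexx.
have ce : c <= e by rewrite le_max lexx orbT.
apply: (@eq_approx _ _ _ (4 * (2 * ((e - - e) * d setT)))) => N.
have h1 := qint_approx N (fun x => wid _ _ be (hb x).1) bb.
have h2 := qint_approx N (fun x => wid _ _ be (hb x).2) bb.
have h3 := qint_approx N (fun x => wid _ _ ce (hc x)) bb.
have h4 : `|qint (constc X 0) - (- e * d setT + riem (R1 mu (constc X 0)) (- e) e N)|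
    <= 2 * ((e - - e) * d setT) / N.+1%:R.
  by apply: qint_approx => // x; apply: (wid b) => //=;
    rewrite /mkcts oppr_le0 b0.
have h5 : riem (R1 mu h) (- e) e N + riem (R1 mu (constc X 0)) (- e) e N =
          riem (R1 mu f) (- e) e N + riem (R1 mu g) (- e) e N.
  by rewrite -!riem_add; apply: eq_bigr => i _; rewrite H.
move: h1 h2 h3 h4 h5; rewrite !ler_norml -(mulrA 4); move: (2 * _ / _) => m.
move: (qint f) (qint g) (qint h) (qint _) (riem _ _ _ _) (riem _ _ _ _).
move: (riem _ _ _ _) (riem _ _ _ _) (_ * d _); clear => r s t u v w x y z; lra.
Qed.

(** At a level [t >= 0] the superlevel set of [f + g] is the disjoint union of those of
[f] and [g]; at [t < 0] that of [f] is everything and only [g] matters. *)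
Lemma qint_disjoint f g h : bounded_cts f -> bounded_cts g -> bounded_cts h ->
  (forall x, f x * g x = 0) -> (forall x, 0 <= f x) ->
  (forall x, 0 <= g x) \/ (forall x, g x <= 0) ->
  (forall x, h x = f x + g x) -> qint h = qint f + qint g.
Proof.
move=> bf bg bh fg0 f0 sg hE; apply: qint_add => // t.
have fg x : f x = 0 \/ g x = 0.
  by have /eqP := fg0 x; rewrite mulf_eq0 => /orP[/eqP|/eqP]; [left|right].
have [t0|t0] := leP 0 t.
  rewrite (@R1_0 _ _ hX _ (constc X 0))// addr0.
  have [g0|g0] := sg; last first.
    rewrite (@R1_0 _ _ hX _ g) ?addr0; last by move=> x;
      exact: le_trans (g0 x) t0.
    by apply/le_anti; rewrite !R1_homo// => x; rewrite hE; have := g0 x;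
      have [->|->] := fg x; rewrite ?addr0 ?add0r// => h1 h2; lra.
  rewrite !R1E -dval_addO//; try exact: open_gt_fun.
    congr d; apply/seteqP; split => x /=; rewrite !in_itv/= !andbT hE.
      by have [->|->] := fg x; rewrite ?addr0 ?add0r; [right|left].
    have := f0 x; have := g0 x.
    by have [->|->] := fg x; rewrite ?addr0 ?add0r => ? ? [] ?; lra.
  apply/seteqP; split => // x [] /=; rewrite !in_itv/= !andbT.
  by have [e|e] := fg x; rewrite e => h1 h2; move: t0;
    [rewrite leNgt h1|rewrite leNgt h2].
rewrite (@R1_T _ _ mu (constc X 0))// (@R1_T _ _ mu f); last first.
  by move=> x; exact: lt_le_trans (f0 x).
rewrite addrC; congr (_ + _).
by apply/le_anti; rewrite !R1_homo// => x; rewrite hE; have := f0 x;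
  have [->|->] := fg x; rewrite ?addr0 ?add0r// => ? ?; lra.
Qed.

(** As [L1 f t = R1 (- f) (- t)], the Riemann sums of the two sides on a symmetric
interval correspond by [riem_reflect]. *)
Lemma Lint_qint f : bounded_cts f -> Defs.Lint mu f = (- qint (oppc f))%:E.
Proof.
move=> /bounded_cts_bound[b0 b00 hb0]; pose b := b0 + 1.
have hb x : - b < f x < b by have := hb0 x; rewrite /b; lra.
have bb : - b <= b by rewrite /b; lra.
have FA t : t < - b -> L1 mu f t = 0.
  move=> tb; rewrite L1_R1 (R1_0 hX)// => x /=; rewrite /mkcts lerNl opprK.
  by have := hb x; lra.
have FB t : b <= t -> L1 mu f t = d setT.
  by move=> tb; rewrite L1_R1 R1_T// => x /=; rewrite /mkcts ltrN2;
    have := hb x; lra.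
have fin N := ls_riemann (L1_nondecreasing mu f) bb FA FB N.
rewrite -[LHS]fineK; last by have [] := fin 0.
congr EFin; apply: (@eq_approx _ _ _ (6 * ((b - - b) * d setT))) => N.
have [_] := fin N; rewrite subr0 -/(Lint mu f).
have oab x : - b <= oppc f x <= b by rewrite /= /mkcts; have := hb x; lra.
have := qint_approx N oab bb.
have -> : 2 * ((b - - b) * d setT) / N.+1%:R = 2 * (mesh (- b) b N * d setT).
  by rewrite /mesh; ring.
have -> : 6 * ((b - - b) * d setT) / N.+1%:R = 6 * (mesh (- b) b N * d setT).
  by rewrite /mesh; ring.
have -> : riem (fun t => d setT - L1 mu f t) (- b) b N =
  d setT * (b - - b) - (riem (R1 mu (oppc f)) (- b) b N - mesh (- b) b N * d setT).
  rewrite riem_add riem_cst riem_opp; congr (_ - _).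
  rewrite (_ : riem _ _ _ _ = riem (fun t => R1 mu (oppc f) (- t)) (- b) b N);
    last first.
    by apply: eq_bigr => i _; rewrite L1_R1.
  rewrite riem_reflect; congr (_ + _); rewrite -mulrN; congr (_ * _).
  rewrite (R1_0 hX) ?sub0r; last by move=> x; case/andP: (oab x).
  by rewrite R1_T// => x /=; rewrite /mkcts ltrN2; case/andP: (hb x).
have : 0 <= mesh (- b) b N * d setT by rewrite mulr_ge0 ?mesh_ge0// dval_ge0.
rewrite !ler_norml mulrBr !mulrN !mulNr opprK [d setT * b]mulrC.
move: (fine _) (qint _) (riem _ _ _ _) (mesh _ _ _ * _) (b * _);
  clear => p q r s t; lra.
Qed.

End DTMIntegral.

(** * Comonotonic additivity *)
Lemma Rintegral_linear d (T : measurableType d) (R : realType)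
    (m : {measure set T -> \bar R}) (p q : T -> R) (a b : R) :
  m.-integrable setT (EFin \o p) -> m.-integrable setT (EFin \o q) ->
  \int[m]_t (a * p t + b * q t) = a * \int[m]_t p t + b * \int[m]_t q t.
Proof.
move=> ip iq.
have iap : m.-integrable setT (EFin \o (fun t => a * p t)).
  by have := integrableZl measurableT a ip; apply: eq_integrable => // x _ /=;
    rewrite EFinM.
have ibq : m.-integrable setT (EFin \o (fun t => b * q t)).
  by have := integrableZl measurableT b iq; apply: eq_integrable => // x _ /=;
    rewrite EFinM.
by rewrite RintegralD// !RintegralZl.
Qed.

Section Comonotone.
Context (X : topologicalType) (R : realType).
Hypothesis hX : hausdorff_space X.
Variable mu : DTM X R.
Local Notation d := (dval mu).
Implicit Types u f g h : continuousType X R.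

(** On a compact subset of [{u > c}] the minimum of [u] exceeds [c], so the subset is
contained in some [{u > s}] with [s > c]; conclude by inner regularity. *)
Lemma R1_right_continuous u c :
  right_lim (R1_nonincreasing mu u) c = - R1 mu u c.
Proof.
apply/le_anti/andP; split; last exact: (right_lim_ge (R1_nonincreasing mu u)).
rewrite lerNr R1E; apply: dval_inner => [|K cK Kc]; first exact: open_gt_fun.
suff [s cs Ks] : exists2 s, c < s & forall x, K x -> s < u x.
  have := right_lim_le (R1_nonincreasing mu u) cs.
  rewrite lerNr; apply: le_trans; rewrite R1E; apply: dval_le.
  - by left; exact: compact_closed.
  - exact: open_gt_fun.
  - by move=> x /Ks /=; rewrite in_itv/= andbT.
have [->|/set0P K0] := eqVneq K set0; first by exists (c + 1) => //;
  rewrite ltrDl.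
have cu : {within K, continuous u} by apply: continuous_subspaceT;
  exact: fun_cts.
have [y Ky hy] := compact_EVT_min K0 cK cu.
have /Kc /= : K y by rewrite inE in Ky.
rewrite in_itv/= andbT => cy; have [h1 h2] := midf_lt cy.
by exists ((c + u y) / 2) => // x Kx; apply: lt_le_trans h2 _; apply: hy;
  rewrite inE.
Qed.

Section RangeMeasure.
Variables (u : continuousType X R) (a b : R).
Hypothesis uab : forall x, a <= u x <= b.
Local Notation r := (ls_measure (R1_nonincreasing mu u)).

Let FA t : t < a -> - R1 mu u t = - d setT.
Proof.
by move=> ta; rewrite R1_T// => x; apply: lt_le_trans ta _; case/andP: (uab x).
Qed.

Let FB t : b <= t -> - R1 mu u t = 0.
Proof.
move=> bt; rewrite (R1_0 hX) ?oppr0// => x; apply: le_trans bt.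
by case/andP: (uab x).
Qed.

Lemma range_measureT : r setT = (d setT)%:E.
Proof. by rewrite [LHS](ls_measure_setT _ FA FB)// sub0r opprK. Qed.

Lemma range_measure_ray c : r `]c, +oo[%classic = (R1 mu u c)%:E.
Proof.
by rewrite [LHS](ls_measure_ray _ FB)// R1_right_continuous sub0r opprK.
Qed.

(** An open up-closed set is empty, the whole line or an open ray.  For other Borel
sets there is no such formula, [mu] not being a measure. *)
Lemma range_measure_up (O : set R) : open O ->
  (forall s t, s <= t -> O s -> O t) -> fine (r O) = d (u @^-1` O).
Proof.
move=> oO up.
have [->|/set0P O0] := eqVneq O set0.
  by rewrite measure0 preimage_set0 (dval0 hX).
have [->|OT] := eqVneq O setT.
  by rewrite preimage_setT [X in fine X]range_measureT.
have [z Oz] : exists z, ~ O z.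
  apply: contrapT => h; move/eqP: OT; apply; apply/seteqP; split => // z _.
  by apply: contrapT => Oz; apply: h; exists z.
have lbz : lbound O z.
  by move=> t Ot; rewrite leNgt; apply/negP => /ltW/up/(_ Ot).
have hi : has_inf O by split => //; exists z.
have -> : O = `]inf O, +oo[%classic.
  apply/seteqP; split => x /=; rewrite in_itv/= andbT => hx.
    move/(_ x hx) : oO => [e /= e0 he].
    have : O (x - e / 2).
      apply: he => /=; rewrite opprB addrC subrK gtr0_norm ?divr_gt0//.
      by rewrite ltr_pdivrMr// ltr_pMr// ltr1n.
    move=> h; apply: le_lt_trans (ge_inf hi.2 h) _.
    by rewrite ltrBlDr ltrDl divr_gt0.
  have [y Oy yx] := inf_lt hi.1 hx.
  by apply: up Oy; exact: ltW.
by rewrite [X in fine X]range_measure_ray R1E.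
Qed.

(** The superlevel sets of [phi] are open and up-closed, so both sides have the same
layer-cake sums by [range_measure_up]. *)
Lemma qint_comp f (phi : R -> R) (p q : R) : continuous phi ->
  {homo phi : s t / s <= t} -> (forall t, p <= phi t <= q) ->
  (forall x, f x = phi (u x)) ->
  r.-integrable setT (EFin \o phi) /\ qint mu f = \int[r]_t phi t.
Proof.
move=> cphi hphi pq fE.
have mphi : measurable_fun setT phi by exact: continuous_measurable_fun.
have rfin : (r setT < +oo)%E by rewrite [X in (X < _)%E]range_measureT ltry.
split; first exact: (bounded_integrable rfin mphi pq).
have pleq : p <= q by have := pq 0 => /andP[]; exact: le_trans.
apply: (@eq_approx _ _ _ (4 * ((q - p) * d setT))) => N.
have := layer_cake rfin N mphi pq.
have := qint_approx hX mu N (_ : forall x, p <= f x <= q) pleq.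
move=> /(_ _) H1 H2.
have {}H1 := H1 (fun x => eq_ind_r (fun y => p <= y <= q) (pq (u x)) (fE x)).
move: H1 H2.
rewrite (_ : fine (_ [set: _]) = d setT);
  last by rewrite [X in fine X]range_measureT.
rewrite (_ : riem (fun t => fine _) p q N = riem (R1 mu f) p q N); last first.
  apply: eq_bigr => i _; congr (_ * _); rewrite R1E.
  rewrite [LHS](range_measure_up (O := [set x | node p q N i < phi x])).
  - congr d; apply/seteqP; split => x /=; rewrite in_itv/= andbT fE//.
  - have := open_comp (fun x _ => cphi x) (rray_open (node p q N i)).
    by congr open; apply/seteqP; split => x /=; rewrite in_itv/= andbT.
  - by move=> s t st /= h; apply: lt_le_trans h (hphi _ _ st).
have -> : 2 * ((q - p) * d setT) / N.+1%:R = 2 * (mesh p q N * d setT).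
  by rewrite /mesh; ring.
have -> : 4 * ((q - p) * d setT) / N.+1%:R = 4 * (mesh p q N * d setT).
  by rewrite /mesh; ring.
have : 0 <= mesh p q N * d setT by rewrite mulr_ge0 ?mesh_ge0// dval_ge0.
rewrite !ler_norml.
move: (qint _ _) (Rintegral _ _ _) (riem _ _ _ _) (mesh _ _ _ * _) (p * _).
by move=> x y z t w; lra.
Qed.

End RangeMeasure.

Lemma closure_inf (A : set R) : has_inf A -> closure A (inf A).
Proof.
move=> hA B /nbhs_ballP[e /= e0 eB].
have [y Ay yA] := inf_adherent e0 hA.
exists y; split => //; apply: eB; rewrite /ball /= ler0_norm.
  by rewrite opprB ltrBlDl.
by rewrite subr_le0; apply: ge_inf => //; case: hA.
Qed.

(** Since [X] is connected, the closure of the range of [u] is an interval, and [phi]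
composed with the projection of the line onto this interval is continuous and
non-decreasing everywhere. *)
Lemma Aplus_extension u g : connected [set: X] -> [set: X] !=set0 ->
  bounded_cts u -> Aplus u g -> exists psi : R -> R, [/\ continuous psi,
    {homo psi : s t / s <= t}, (exists p q, forall t, p <= psi t <= q) &
    forall x, g x = psi (u x)].
Proof.
move=> cX [x0 _] [b hb] [phi [cphi hphi _ gE]].
pose C := closure (range u).
have ru0 : range u !=set0 by exists (u x0), x0.
have hsup : has_sup (range u).
  by split => //; exists b => _ [x _ <-]; exact: le_trans (ler_norm _) (hb x).
have hinf : has_inf (range u).
  by split => //; exists (- b) => _ [x _ <-]; have := hb x;
    rewrite ler_norml => /andP[].
pose lo := inf (range u); pose hi := sup (range u).
have loC : C lo by exact: closure_inf.
have hiC : C hi by apply: closure_sup => //; case: hsup.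
have ulo x : lo <= u x by apply: ge_inf; [case: hinf|exists x].
have uhi x : u x <= hi by apply: sup_ubound; [case: hsup|exists x].
have lohi : lo <= hi := le_trans (ulo x0) (uhi x0).
have itvC t : lo <= t <= hi -> C t.
  move=> /andP[lt th].
  have [->//|tlo] := eqVneq t lo; have [->//|thi] := eqVneq t hi.
  have {}lt : lo < t by rewrite lt_def tlo.
  have {}th : t < hi by rewrite lt_def eq_sym thi.
  have /connected_intervalP iu : connected (range u).
    by apply: connected_continuous_connected => //;
      apply: continuous_subspaceT; exact: fun_cts.
  have [y [x _ <-] xt] := inf_lt ru0 lt.
  have [z [w _ <-] tw] := sup_gt ru0 th.
  apply: subset_closure; apply: (iu (u x) (u w)); [by exists x|by exists w|].
  by rewrite !ltW.
pose cl t := Num.max lo (Num.min t hi).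
have clb t : lo <= cl t <= hi.
  by rewrite /cl le_max lexx/= ge_max lohi ge_min lexx orbT.
have clC t : C (cl t) by exact: itvC.
have clh s t : s <= t -> cl s <= cl t.
  by move=> st; rewrite /cl ge_max !le_max lexx/= !le_min !ge_min st lexx !orbT/=.
have ccl : continuous cl.
  move=> t; apply: (@continuous_max R R (cst lo) (fun t => Num.min t hi));
    first exact: cvg_cst.
  by apply: (@continuous_min R R id (cst hi)); [exact: cvg_id|exact: cvg_cst].
exists (phi \o cl); split.
- move=> t V /= Vt.
  have : (phi @ (within C (nbhs (cl t)))) V.
    by move/subspace_continuousP : cphi => /(_ _ (clC t)); apply.
  by move=> /ccl; apply: (@filterS _ (nbhs t)) => s; apply; exact: clC.
- by move=> s t st /=; apply: hphi; rewrite ?inE//;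
    [exact: clC|exact: clC|exact: clh].
- exists (phi lo), (phi hi) => t /=; have /andP[h1 h2] := clb t.
  by apply/andP; split; apply: hphi; rewrite ?inE//; exact: clC.
- by move=> x /=; rewrite gE /cl (min_idPl (uhi x)) (max_idPr (ulo x)).
Qed.

(** The three quasi-integrals are integrals against the same Stieltjes measure, that
of [u], and these are linear in the integrand. *)
Lemma qint_Aplus u g h (k : continuousType X R) (a b : R) :
  connected [set: X] -> bounded_cts u -> Aplus u g -> Aplus u h -> 0 <= a -> 0 <= b ->
  (forall x, k x = a * g x + b * h x) ->
  qint mu k = a * qint mu g + b * qint mu h.
Proof.
move=> cX bu ug uh a0 b0 kE.
(* on the empty space every function is the constant 0 *)
have [X0|/set0P X0] := eqVneq [set: X] set0.
  have e (f : continuousType X R) : qint mu f = 0.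
    rewrite (@qint_cst _ _ hX mu 0) ?mul0r// => x.
    by have : set0 x by rewrite -X0.
  by rewrite !e !mulr0 addr0.
have [p [cp hp [p1 [p2 pb]] gE]] := Aplus_extension cX X0 bu ug.
have [q [cq hq [q1 [q2 qb]] hE]] := Aplus_extension cX X0 bu uh.
have [c c0 ub] := bounded_cts_bound bu.
have [ip eg] := qint_comp ub cp hp pb gE.
have [iq eh] := qint_comp ub cq hq qb hE.
have [||||_ ->] :=
  @qint_comp _ _ _ ub k (fun t => a * p t + b * q t)
    (a * p1 + b * q1) (a * p2 + b * q2).
- move=> t; apply: cvgD; apply: cvgM; by [exact: cvg_cst|exact: cp|exact: cq].
- by move=> s t st; exact: lerD (ler_wpM2l a0 (hp _ _ st)) (ler_wpM2l b0 (hq _ _ st)).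
- move=> t; have /andP[? ?] := pb t; have /andP[? ?] := qb t.
  by apply/andP; split; apply: lerD; rewrite ler_wpM2l.
- by move=> x; rewrite kE gE hE.
by rewrite eg eh; exact: Rintegral_linear.
Qed.

End Comonotone.

(** * From a functional to a deficient topological measure *)
Section LayeredFunctionals.
Context (X : topologicalType) (R : realType).
Implicit Types f g h : continuousType X R.

Lemma supp_ne f x : f x != 0 -> supp f x.
Proof. exact: (@subset_closure X [set y | f y != 0]). Qed.

Lemma C0p_constc0 : C0p X R (constc X 0).
Proof.
split=> [e e0|x //]; rewrite (_ : [set _ | _] = set0); first exact: compact0.
by apply/seteqP; split => // x /=; rewrite /constc /mkcts normr0 leNgt e0.
Qed.

Lemma C0p_sub f g : C0p X R f -> (forall x, 0 <= g x <= f x) -> C0p X R g.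
Proof.
move=> [cf f0] gf; split => [|x]; last by case/andP: (gf x).
by apply: C0_sub cf _ => x; have /andP[g0 gle] := gf x; rewrite !ger0_norm.
Qed.

Lemma C0p_minc f c : 0 <= c -> C0p X R f -> C0p X R (minc f c).
Proof.
move=> c0 hf; apply: (C0p_sub hf) => x; rewrite /= /mkcts le_min ge_min lexx c0.
by case: hf => _ ->.
Qed.

Lemma C0p_excess f c : 0 <= c -> C0p X R f -> C0p X R (excess f c).
Proof.
move=> c0 hf; apply: (C0p_sub hf) => x;
  rewrite /= /mkcts le_max lexx orbT ge_max.
by case: hf => _ ->; rewrite andbT/= lerBlDr lerDl.
Qed.

Lemma C0p_scalec f c : 0 <= c -> C0p X R f -> C0p X R (scalec f c).
Proof. by move=> c0 [cf f0]; split; [exact: C0_scale|move=> x;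
  rewrite mulr_ge0]. Qed.

Lemma C0p_addc f g : C0p X R f -> C0p X R g -> C0p X R (addc f g).
Proof. by move=> [cf f0] [cg g0]; split; [exact: C0_add|move=> x;
  rewrite addr_ge0]. Qed.

(** The common ground of the functionals considered here, for functions in [C0p]:
the fourth property replaces the additivity on [Aplus f], and is all that cutting
[f] into slices requires. *)
Definition layered (r : continuousType X R -> R) (M : R) :=
  [/\ (forall f g h, C0p X R f -> C0p X R g -> (forall x, f x * g x = 0) ->
        (forall x, h x = f x + g x) -> r h = r f + r g),
      (forall f g, C0p X R f -> C0p X R g -> (forall x, g x <= f x) ->
        r g <= r f),
      (forall f a, C0p X R f -> 0 < a -> r (scalec f a) = a * r f),
      (forall f c, C0p X R f -> 0 <= c -> r f = r (minc f c) + r (excess f c)) &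
      (forall f, C0p X R f -> (forall x, f x <= 1) -> r f <= M)].

(** The restriction of [r] to the domain on which [mu_of] takes its test functions. *)
Definition posfun (r : continuousType X R -> R) : C0p X R -> \bar R :=
  fun u => (r (\val u))%:E.

Section TestFunctions.
Variable r : continuousType X R -> R.
Local Notation mO := (mu_of_open (posfun r)).
Local Open Scope ereal_scope.

Lemma mu_of_open_ge f U : Cc X R f -> (forall x, (0 <= f x <= 1)%R) ->
  supp f `<=` U -> (r f)%:E <= mO U.
Proof.
move=> cf f01 fU.
have hf : C0p X R f by split; [exact: Cc_C0|move=> x; case/andP: (f01 x)].
by apply: ereal_sup_ubound; exists (elt hf).
Qed.

Lemma mu_of_open_le U y :
  (forall f, Cc X R f -> (forall x, (0 <= f x <= 1)%R) -> supp f `<=` U ->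
    (r f)%:E <= y) -> mO U <= y.
Proof. by move=> h; apply: ge_ereal_sup => _ [f [cf f01 fU] <-]; exact: h. Qed.

Lemma mu_of_open_homo U V : U `<=` V -> mO U <= mO V.
Proof.
move=> UV; apply: mu_of_open_le => f cf f01 fU; apply: mu_of_open_ge => //.
exact: subset_trans UV.
Qed.

Lemma mu_of_openE (A : closed_or_open X) : open (\val A) ->
  mu_of (posfun r) A = mO (\val A).
Proof. by rewrite /mu_of => oA; rewrite asboolT. Qed.

(** For open sets both descriptions agree by monotonicity. *)
Lemma mu_of_inf (A : closed_or_open X) : mu_of (posfun r) A =
  ereal_inf [set mO U | U in [set U | open U /\ \val A `<=` U]].
Proof.
rewrite /mu_of; case: ifPn => // /asboolP oA; apply/le_anti/andP; split.
  by apply: le_ereal_inf_tmp => _ [U [_ AU] <-]; exact: mu_of_open_homo.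
by apply: ereal_inf_lbound; exists (\val A) => //; split.
Qed.

Lemma mu_of_le (A : closed_or_open X) U : open U -> \val A `<=` U ->
  mu_of (posfun r) A <= mO U.
Proof. by move=> oU AU; rewrite mu_of_inf; apply: ereal_inf_lbound;
  exists U. Qed.

End TestFunctions.

Section FunctionalToMeasure.
Variables (r : continuousType X R -> R) (M : R).
Hypothesis hr : layered r M.
Hypothesis hX : hausdorff_space X.
Hypothesis lcX : locally_compact [set: X].
Local Notation mO := (mu_of_open (posfun r)).

Lemma layered0 : r (constc X 0) = 0.
Proof.
case: hr => add _ _ _ _.
have := add _ _ (constc X 0) C0p_constc0 C0p_constc0
  (fun x => mulr0 _) (fun x => esym (addr0 _)).
by move/eqP; rewrite -subr_eq subrr => /eqP.
Qed.

Lemma test_C0p f : Cc X R f -> (forall x, 0 <= f x <= 1) -> C0p X R f.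
Proof. by move=> cf f01; split; [exact: Cc_C0|move=> x;
  case/andP: (f01 x)]. Qed.

Lemma mu_of_open_ge0 U : (0 <= mO U)%E.
Proof.
rewrite -[0%E]/(0%:E) -layered0; apply: mu_of_open_ge.
- rewrite /Cc /= /supp (_ : [set _ | _] = set0) ?closure0;
    first exact: compact0.
  by apply/seteqP; split => // x /=; rewrite /constc /mkcts eqxx.
- by move=> x; rewrite /= /mkcts lexx ler01.
- rewrite /supp (_ : [set _ | _] = set0) ?closure0//.
  by apply/seteqP; split => // x /=; rewrite /constc /mkcts eqxx.
Qed.

Lemma mu_of_open_leM U : (mO U <= M%:E)%E.
Proof.
case: hr => _ _ _ _ bdd.
apply: mu_of_open_le => f cf f01 _; rewrite lee_fin; apply: bdd.
  exact: test_C0p.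
by move=> x; case/andP: (f01 x).
Qed.

Lemma mu_of_open_fin U : mO U \is a fin_num.
Proof. by rewrite ge0_fin_numE ?mu_of_open_ge0// (le_lt_trans (mu_of_open_leM U))//
  ltry. Qed.

(** Test functions for [U] and [V] have product zero, so their sum is a test function
for the union. *)
Lemma mu_of_open_super U V : U `&` V = set0 ->
  (mO U + mO V <= mO (U `|` V))%E.
Proof.
move=> UV0; case: hr => add _ _ _ _.
rewrite -leeBrDr ?mu_of_open_fin//; apply: mu_of_open_le => f cf f01 fU.
rewrite leeBrDr ?mu_of_open_fin// addeC -leeBrDr//.
apply: mu_of_open_le => g cg g01 gV; rewrite leeBrDr// addeC -EFinD.
have fg x : f x = 0 \/ g x = 0.
  apply: contrapT => /not_orP[/eqP fx /eqP gx].
  have : (U `&` V) x by split; [apply/fU|apply/gV]; exact: supp_ne.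
  by rewrite UV0.
have sfg : supp (addc f g) `<=` supp f `|` supp g.
  rewrite /supp -closureU; apply: closureS => x /=.
  rewrite /mkcts => h; apply: contrapT => /not_orP[/negP/negPn/eqP fx /negP/negPn/eqP gx].
  by move: h; rewrite fx gx addr0 eqxx.
rewrite -(add f g (addc f g))//; try exact: test_C0p; last first.
  by move=> x; have [->|->] := fg x; rewrite ?mul0r ?mulr0.
apply: mu_of_open_ge.
- apply: subclosed_compact (compactU cf cg) sfg; exact: closed_closure.
- move=> x; rewrite /= /mkcts; have := f01 x; have := g01 x.
  by have [->|->] := fg x; rewrite ?add0r ?addr0.
- by apply: subset_trans sfg _; exact: setUSS.
Qed.

(** The extension by 0 stays continuous because the support of [f] is covered by two
disjoint open sets. *)
Lemma supp_restrict f U V : open U -> open V -> U `&` V = set0 ->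
  supp f `<=` U `|` V -> Cc X R f -> (forall x, 0 <= f x <= 1) ->
  exists g : continuousType X R,
    [/\ Cc X R g, forall x, 0 <= g x <= 1, supp g `<=` U &
        forall x, g x = if x \in U then f x else 0].
Proof.
move=> oU oV UV0 fUV cf f01; pose g x := if x \in U then f x else 0.
have gV x : V x -> g x = 0.
  by move=> Vx; rewrite /g memNset// => Ux; rewrite -[False]/(set0 x) -UV0.
have cg : continuous g.
  move=> x; have [Ux|Ux] := pselect (U x).
    have gx : g x = f x by rewrite /g mem_set.
    rewrite /continuous_at gx; have := @fun_cts _ _ f x; apply: cvg_trans.
    apply: near_eq_cvg; have : nbhs x U by exact: open_nbhs_nbhs.
    by apply: filterS => y Uy; rewrite /g mem_set.
  have gx : g x = 0 by rewrite /g memNset.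
  rewrite /continuous_at gx; apply: cvg_near_cst.
  have : nbhs x (V `|` ~` supp f).
    apply: open_nbhs_nbhs; split.
      by apply: openU => //; apply: closed_openC; exact: closed_closure.
    have [/fUV[//|Vx]|fx] := pselect (supp f x); [by left|by right].
  apply: filterS => y [/gV->//|fy]; rewrite /g; case: ifP => // _.
  by apply/eqP; apply: contrapT => /negP fy0; apply: fy; exact: supp_ne.
have sg : supp (mkcts cg) `<=` supp f `&` ~` V.
  rewrite /supp; have -> : ~` V = closure (~` V).
    by apply/closure_id; exact: open_closedC.
  apply: subset_trans (closureI (A := [set x | f x != 0]) (B := ~` V)).
  apply: closureS => x /=; rewrite /mkcts => gx; split.
    by apply: contraNneq gx; rewrite /g => ->; rewrite if_same.
  by move=> /gV gx0; rewrite gx0 eqxx in gx.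
exists (mkcts cg); split => //.
- apply: subclosed_compact cf _; first exact: closed_closure.
  by apply: subset_trans sg _; exact: subIsetl.
- by move=> x; rewrite /= /mkcts /g; case: ifP => //; rewrite lexx ler01.
- by move=> x /sg [/fUV[//|Vx] nV].
Qed.

Lemma mu_of_open_sub U V : open U -> open V -> U `&` V = set0 ->
  (mO (U `|` V) <= mO U + mO V)%E.
Proof.
move=> oU oV UV0; case: hr => add _ _ _ _; apply: mu_of_open_le => f cf f01 fUV.
have [g [cg g01 gU gE]] := supp_restrict oU oV UV0 fUV cf f01.
have [h [ch h01 hV hE]] : exists g : continuousType X R,
    [/\ Cc X R g, forall x, 0 <= g x <= 1, supp g `<=` V &
        forall x, g x = if x \in V then f x else 0].
  by apply: (supp_restrict oV oU _ _ cf f01); [rewrite setIC|rewrite setUC].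
have UVx x : x \in U -> x \in V -> False.
  by rewrite !inE => Ux Vx; rewrite -[False]/(set0 x) -UV0.
rewrite (add g h f); [|exact: test_C0p|exact: test_C0p| |].
- by rewrite EFinD; apply: leeD; exact: mu_of_open_ge.
- move=> x; rewrite gE hE; have := UVx x.
  by case: (x \in U); case: (x \in V); rewrite ?mulr0 ?mul0r// => /(_ isT isT).
- move=> x; rewrite gE hE; have := UVx x.
  case: ifPn => xU; case: ifPn => xV; rewrite ?addr0 ?add0r//;
    first by move=> /(_ isT isT).
  move=> _; apply/eqP; apply: contrapT => /negP fx.
  have := fUV x (supp_ne fx); rewrite notin_setE in xU;
    rewrite notin_setE in xV.
  by case.
Qed.

Lemma disjoint_compact_opens (K L : set X) :
  compact K -> compact L -> K `&` L = set0 ->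
  exists U V, [/\ open U, open V, K `<=` U, L `<=` V & U `&` V = set0].
Proof.
move=> cK cL KL0; have clL := compact_closed hX cL.
have [||f [_ f01 f1 fL]] := @compact_open_separation X R lcX hX K (~` L) cK.
- exact: closed_openC.
- by move=> x Kx Lx; rewrite -[False]/(set0 x) -KL0.
exists (f @^-1` `]2^-1, +oo[), (f @^-1` `]-oo, 2^-1[); split.
- exact: open_gt_fun.
- exact: open_lt_fun.
- by move=> x Kx; rewrite /= in_itv/= f1// andbT invf_lt1 ?ltr1n.
- move=> x Lx; rewrite /= in_itv/=; have -> : f x = 0; last by rewrite invr_gt0.
  by apply/eqP; apply: contrapT => /negP fx; apply: (fL x) => //;
    exact: supp_ne.
- apply/seteqP; split => // x [] /=; rewrite !in_itv/= andbT => h1 h2.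
  by have := lt_trans h1 h2; rewrite ltxx.
Qed.

(** For additivity on compact sets, work inside disjoint open neighborhoods, where
test functions split ([mu_of_open_sub]) and add up ([mu_of_open_super]). *)
Lemma mu_of_DTM : DTM X R (mu_of (posfun r)).
Proof.
have mule A : (0 <= mu_of (posfun r) A)%E.
  rewrite mu_of_inf; apply: le_ereal_inf_tmp => _ [U _ <-];
    exact: mu_of_open_ge0.
split; last first.
  rewrite mu_of_openE; last exact: openT.
  by apply: le_lt_trans (mu_of_open_leM _) _; rewrite ltry.
split => //.
- move=> K1 K2 K c1 c2 K120 KE.
  have [U [V [oU oV KU KV UV0]]] := disjoint_compact_opens c1 c2 K120.
  have fin A : mu_of (posfun r) A \is a fin_num.
    rewrite ge0_fin_numE//; apply: le_lt_trans (_ : M%:E < +oo)%E;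
      last by rewrite ltry.
    by apply: le_trans (mu_of_open_leM setT); apply: mu_of_le => //;
      exact: openT.
  apply/le_anti/andP; split.
    rewrite -leeBlDr// [X in (_ <= X)%E]mu_of_inf.
    apply: le_ereal_inf_tmp => _ [U' [oU' KU'] <-].
    rewrite leeBlDr// addeC -leeBlDr ?mu_of_open_fin// [X in (_ <= X)%E]mu_of_inf.
    apply: le_ereal_inf_tmp => _ [V' [oV' KV'] <-].
    rewrite leeBlDr ?mu_of_open_fin//.
    apply: (@le_trans _ _ (mO ((U `&` U') `|` (V `&` V')))).
      apply: mu_of_le; first by apply: openU; exact: openI.
      by rewrite KE; apply: setUSS; rewrite subsetI.
    apply: le_trans (mu_of_open_sub _ _ _) _; try exact: openI.
      by rewrite setIACA UV0 set0I.
    rewrite addeC; apply: leeD; apply: mu_of_open_homo; exact: subIsetr.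
  rewrite [X in (_ <= X)%E]mu_of_inf;
    apply: le_ereal_inf_tmp => _ [W [oW KW] <-].
  apply: (@le_trans _ _ (mO (U `&` W) + mO (V `&` W))%E).
    apply: leeD; apply: mu_of_le; try exact: openI; rewrite subsetI;
      split => //.
      by apply: subset_trans KW; rewrite KE; exact: subsetUl.
    by apply: subset_trans KW; rewrite KE; exact: subsetUr.
  apply: le_trans (mu_of_open_super _) _; first by rewrite setIACA UV0 set0I.
  by apply: mu_of_open_homo => x [[]|[]].
- move=> U oU; apply/le_anti/andP; split.
    rewrite mu_of_openE//; apply: mu_of_open_le => f cf f01 fU.
    have h : closed_or_open X (supp f) by left; exact: closed_closure.
    apply: (@le_trans _ _ (mu_of (posfun r) (elt h))).
      rewrite mu_of_inf; apply: le_ereal_inf_tmp => _ [V [oV fV] <-].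
      exact: mu_of_open_ge.
    by apply: ereal_sup_ubound; exists (elt h).
  apply: ge_ereal_sup => _ [K [cK KU] <-].
  by rewrite [X in (_ <= X)%E]mu_of_openE//; exact: mu_of_le.
- move=> F clF; rewrite mu_of_inf; congr ereal_inf; apply/seteqP; split.
    move=> _ [U [oU FU] <-]; exists (oset oU) => //.
    by rewrite mu_of_openE.
  by move=> _ [U [oU FU] <-]; exists (\val U) => //; rewrite mu_of_openE.
Qed.

End FunctionalToMeasure.
End LayeredFunctionals.

(** * Representation of layered functionals *)
Section Representation.
Context (X : topologicalType) (R : realType).
Hypotheses (hX : hausdorff_space X) (lcX : locally_compact [set: X]).
Implicit Types f g h : continuousType X R.

Section FunctionalIsIntegral.
Variables (r : continuousType X R -> R) (M : R).
Hypothesis hr : layered r M.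

Definition dtm_of_layered : DTM X R :=
  elt (mu_of_DTM hr hX lcX).
Local Notation d := (dval dtm_of_layered).

Lemma dval_dtm_of_layered U : open U -> d U = fine (mu_of_open (posfun r) U).
Proof. by move=> oU; rewrite -[U]/(\val (oset oU)) dvalE /= mu_of_openE. Qed.

Lemma dtm_of_layered_le U : open U -> d U <= M.
Proof.
move=> oU; rewrite dval_dtm_of_layered// -lee_fin fineK ?(mu_of_open_leM hr)//.
exact: (mu_of_open_fin hr).
Qed.

Section Layers.
Variables (f : continuousType X R) (s t : R).
Hypotheses (hf : C0p X R f) (s0 : 0 <= s) (st : s < t).

(** Lies between the indicators of [{f >= t}] and [{f > s}], which is how [r] is
compared with the values of the measure on level sets. *)
Definition slice := scalec (excess (minc f t) s) (t - s)^-1.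

Lemma slice_C0p : C0p X R slice.
Proof.
apply: C0p_scalec; first by rewrite invr_ge0 subr_ge0 ltW.
by apply: C0p_excess => //; apply: C0p_minc => //;
  exact: ltW (le_lt_trans s0 st).
Qed.

Lemma slice_le1 x : slice x <= 1.
Proof.
rewrite /slice /= /mkcts mulrC ler_pdivrMr ?subr_gt0// mul1r ge_max subr_ge0 (ltW st) andbT.
by rewrite lerD2r ge_min lexx orbT.
Qed.

Lemma slice_eq1 x : t <= f x -> slice x = 1.
Proof.
move=> h; rewrite /slice /= /mkcts (min_idPr h) (max_idPl _) ?subr_ge0 ?(ltW st)//.
by rewrite mulVf// subr_eq0 gt_eqF.
Qed.

Lemma slice_eq0 x : f x <= s -> slice x = 0.
Proof.
move=> h; rewrite /slice /= /mkcts (max_idPr _) ?mulr0// subr_le0.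
by rewrite ge_min h.
Qed.

Lemma layered_slice : r (minc f t) = r (minc f s) + (t - s) * r slice.
Proof.
case: hr => _ _ hom lay _; have t0 := ltW (le_lt_trans s0 st).
rewrite (lay _ s (C0p_minc t0 hf) s0); congr (r _ + _).
  by apply: cts_ext => x; rewrite /= /mkcts -minA (min_idPr (ltW st)).
rewrite hom; last 2 first.
- by apply: C0p_excess => //; exact: C0p_minc.
- by rewrite invr_gt0 subr_gt0.
by rewrite mulrA mulfV ?mul1r// subr_eq0 gt_eqF.
Qed.

Lemma slice_ge : R1 dtm_of_layered f t <= r slice.
Proof.
case: hr => _ mono _ _ _.
have oU : open (f @^-1` `]t, +oo[%classic) by exact: open_gt_fun.
rewrite R1E dval_dtm_of_layered// -lee_fin fineK;
  last exact: (mu_of_open_fin hr).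
apply: mu_of_open_le => g cg g01 gU; rewrite lee_fin; apply: mono.
- exact: slice_C0p.
- exact: test_C0p.
move=> x; have [->|gx] := eqVneq (g x) 0; first by case: slice_C0p.
have := gU _ (supp_ne gx); rewrite /= in_itv/= andbT => tx.
by rewrite slice_eq1 ?(ltW tx)//; case/andP: (g01 x).
Qed.

Lemma slice_leM : r slice <= M.
Proof. by case: hr => _ _ _ _; apply; [exact: slice_C0p|exact: slice_le1]. Qed.

Lemma slice_le u : 0 < s -> u < s -> r slice <= R1 dtm_of_layered f u.
Proof.
move=> s1 us; have oU : open (f @^-1` `]u, +oo[%classic) by exact: open_gt_fun.
rewrite R1E dval_dtm_of_layered// -lee_fin fineK;
  last exact: (mu_of_open_fin hr).
have sS : supp slice `<=` [set x | s <= f x].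
  rewrite [X in _ `<=` X](closure_id _).1; last exact: closed_fun_ge.
  by apply: closureS => x /=; apply: contra_neqT;
    rewrite -ltNge => /ltW/slice_eq0.
apply: mu_of_open_ge.
- have [c0 f0] := hf; apply: subclosed_compact (c0 s s1) _;
    first exact: closed_closure.
  by move=> x /sS /=; rewrite ger0_norm.
- by move=> x; rewrite slice_le1 andbT; case: slice_C0p.
- by move=> x /sS /= h; rewrite in_itv/= andbT (lt_le_trans us).
Qed.

End Layers.

(** The truncations of [f] at the nodes telescope. *)
Lemma layered_sum f b N : C0p X R f -> 0 < b -> (forall x, f x <= b) ->
  r f = \sum_(i < N.+1)
    mesh 0 b N * r (slice f (node 0 b N i) (node 0 b N i.+1)).
Proof.
move=> hf b0 fb; have m0 : 0 < mesh 0 b N by rewrite /mesh subr0 divr_gt0.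
have n0 i : 0 <= node 0 b N i by rewrite /node add0r mulr_ge0// ltW.
have nS i : node 0 b N i < node 0 b N i.+1 by rewrite nodeS ltrDl.
transitivity (\sum_(0 <= i < N.+1)
    (r (minc f (node 0 b N i.+1)) - r (minc f (node 0 b N i)))).
  rewrite telescope_sumr// node_last node0 -[LHS]subr0; congr (r _ - _).
    by apply: cts_ext => x; rewrite /= /mkcts (min_idPl (fb x)).
  rewrite -[LHS](layered0 hr); congr r; apply: cts_ext => x; rewrite /= /mkcts.
  by case: hf => _ f0; rewrite (min_idPr (f0 x)).
rewrite big_mkord; apply: eq_bigr => i _.
by rewrite (layered_slice hf (n0 i) (nS i)) addrC addKr nodeS addrAC subrr add0r.
Qed.

(** The value of [r] at a slice lies between the measures of neighboring level sets.
Only the lowest slice may fail to have compact support; it is estimated by the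
bound [M], with the weight of one mesh. *)
Lemma layered_qint f : C0p X R f -> r f = qint dtm_of_layered f.
Proof.
move=> hf; have [b b0 fb] := C0p_bounded hf.
have fb' x : f x <= b by case/andP: (fb x).
pose D := d setT.
have DM : D <= M by exact: dtm_of_layered_le openT.
have D0 : 0 <= D by exact: dval_ge0.
apply: (@eq_approx _ _ _ (b * (2 * D + M))) => N.
have := qint_approx hX dtm_of_layered N fb (ltW b0).
rewrite subr0 mul0r add0r -/D.
have m0 : 0 < mesh 0 b N by rewrite /mesh subr0 divr_gt0.
have n0 i : 0 <= node 0 b N i by rewrite /node add0r mulr_ge0// ltW.
have nS i : node 0 b N i < node 0 b N i.+1 by rewrite nodeS ltrDl.
have -> : 2 * (b * D) / N.+1%:R = 2 * (mesh 0 b N * D) by rewrite /mesh; ring.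
have -> : b * (2 * D + M) / N.+1%:R = 2 * (mesh 0 b N * D) + mesh 0 b N * M.
  by rewrite /mesh; ring.
have lo : riem (R1 dtm_of_layered f) 0 b N - mesh 0 b N * D <= r f.
  rewrite (layered_sum N hf b0 fb').
  apply: (@le_trans _ _ (\sum_(0 <= i < N.+1)
      mesh 0 b N * R1 dtm_of_layered f (node 0 b N i.+1))).
    pose g i := mesh 0 b N * R1 dtm_of_layered f (node 0 b N i).
    rewrite lerBlDr -lerBlDl /riem -(big_mkord xpredT g).
    rewrite -sumrB -[X in X <= _]opprK -sumrN.
    rewrite (eq_bigr (fun i => g i.+1 - g i)); last by move=> i _;
      rewrite opprB.
    rewrite (telescope_sumr g)// opprB -mulrBr ler_pM2l//.
    by rewrite lerBlDr -[X in X <= _]addr0 lerD ?R1_leT ?R1_ge0.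
  by rewrite big_mkord; apply: ler_sum => i _; rewrite ler_pM2l// slice_ge.
have hi : r f <= riem (R1 dtm_of_layered f) 0 b N + mesh 0 b N * M.
  rewrite (layered_sum N hf b0 fb') big_ord_recl /= addrC; apply: lerD;
    last first.
    by rewrite ler_pM2l//; apply: slice_leM.
  rewrite /riem big_ord_recr/= -[X in X <= _]addr0; apply: lerD; last first.
    by rewrite mulr_ge0 ?R1_ge0// ltW.
  apply: ler_sum => i _; rewrite ler_pM2l//; apply: slice_le => //.
  exact: le_lt_trans (n0 i) (nS i).
have DM' : mesh 0 b N * D <= mesh 0 b N * M by rewrite ler_pM2l.
move: lo hi DM'; rewrite !ler_norml.
move: (r f) (qint _ _) (riem _ _ _ _) (mesh _ _ _ * D) (mesh _ _ _ * M) => p q s t u; lra.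
Qed.

End FunctionalIsIntegral.

Lemma qint_plateau (mu : DTM X R) f K : C0p X R f -> (forall x, f x <= 1) ->
  compact K -> (forall x, K x -> f x = 1) -> dval mu K <= qint mu f.
Proof.
move=> hf f1 cK fK.
have f01 x : 0 <= f x <= 1 by rewrite f1 andbT; case: hf.
apply: (@le_approx _ _ _ (2 * ((1 - 0) * dval mu setT))) => N.
have := qint_approx hX mu N f01 ler01.
have : dval mu K <= riem (R1 mu f) 0 1 N.
  rewrite -[X in X <= _]mulr1 -[X in _ * X]subr0 -(riem_cst _ 0 1 N).
  apply: riem_le => // t /andP[_ t1]; rewrite R1E; apply: dval_le.
  - by left; exact: compact_closed.
  - exact: open_gt_fun.
  - by move=> x Kx; rewrite /= in_itv/= andbT fK.
rewrite ler_norml mul0r add0r.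
move: (qint mu f) (riem _ _ _ _) (_ / N.+1%:R) (dval mu K) => p r s t; lra.
Qed.

Lemma qint_test (mu : DTM X R) f U : C0p X R f -> (forall x, f x <= 1) ->
  open U -> supp f `<=` U -> qint mu f <= dval mu U.
Proof.
move=> hf f1 oU fU.
have f01 x : 0 <= f x <= 1 by rewrite f1 andbT; case: hf.
apply: (@le_approx _ _ _ (2 * ((1 - 0) * dval mu setT))) => N.
have := qint_approx hX mu N f01 ler01.
have : riem (R1 mu f) 0 1 N <= dval mu U.
  rewrite -[X in _ <= X]mulr1 -[X in _ * X]subr0 -(riem_cst _ 0 1 N).
  apply: riem_le => // t /andP[t0 _]; rewrite R1E; apply: dval_le => //.
    by right; exact: open_gt_fun.
  move=> x /=; rewrite in_itv/= andbT => tx; apply: fU; apply: supp_ne.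
  by rewrite gt_eqF// (le_lt_trans t0).
rewrite ler_norml mul0r add0r.
move: (qint mu f) (riem _ _ _ _) (_ / N.+1%:R) (dval mu U) => p r s t; lra.
Qed.

(** Test functions of [U] have quasi-integral at most [mu U]; conversely a Urysohn
function equal to 1 on a compact [K] has quasi-integral at least [mu K]. *)
Lemma mu_of_open_qint (mu : DTM X R) U : open U ->
  mu_of_open (posfun (qint mu)) U = (dval mu U)%:E.
Proof.
move=> oU; apply/le_anti/andP; split.
  apply: mu_of_open_le => f cf f01 fU; rewrite lee_fin; apply: qint_test => //.
    exact: test_C0p.
  by move=> x; case/andP: (f01 x).
have fin : (mu_of_open (posfun (qint mu)) U \is a fin_num)%E.
  rewrite fin_numE; apply/andP; split.
    rewrite -ltNye; have [f [cf f01 _ fU]] := compact_open_separation R lcX hX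
      (@compact0 X) oU (@sub0set _ _).
    by apply: lt_le_trans (mu_of_open_ge _ cf f01 fU); rewrite ltNyr.
  rewrite -ltey; apply: le_lt_trans (_ : (dval mu U)%:E < +oo)%E;
    last by rewrite ltry.
  apply: mu_of_open_le => f cf f01 fU; rewrite lee_fin; apply: qint_test => //.
    exact: test_C0p.
  by move=> x; case/andP: (f01 x).
rewrite -(fineK fin) lee_fin; apply: dval_inner => // K cK KU.
have [f [cf f01 f1 fU]] := compact_open_separation R lcX hX cK oU KU.
rewrite -lee_fin fineK//; apply: le_trans (mu_of_open_ge (qint mu) cf f01 fU).
rewrite lee_fin; apply: qint_plateau => //; first exact: test_C0p.
by move=> x; case/andP: (f01 x).
Qed.

Lemma mu_of_qint (mu : DTM X R) : mu_of (posfun (qint mu)) = \val mu.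
Proof.
apply/funext => A; have [clA|oA] := set_valP A; last first.
  by rewrite mu_of_openE// mu_of_open_qint// DTM_dval.
case: (set_valP mu) => -[_ _ _ out] _; rewrite mu_of_inf out//.
congr ereal_inf; apply/seteqP; split => _ [U [oU AU] <-].
  by exists (oset oU) => //; rewrite mu_of_open_qint// DTM_dval.
by exists (\val U) => //; rewrite mu_of_open_qint// DTM_dval.
Qed.

Lemma qint_inj (mu nu : DTM X R) :
  (forall f, C0p X R f -> qint mu f = qint nu f) -> mu = nu.
Proof.
move=> h; have e : posfun (qint mu) = posfun (qint nu).
  by apply/funext => f; rewrite /posfun h//; exact: set_valP.
apply: val_inj; transitivity (mu_of (posfun (qint mu))).
  exact: esym (mu_of_qint mu).
by rewrite e; exact: mu_of_qint.
Qed.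

End Representation.

(** * Conic functionals are layered *)
Section FunctionalsOnDomains.
Context (X : topologicalType) (R : realType).
Variable D : set (continuousType X R).
Implicit Types (f g h : continuousType X R) (rho : D -> \bar R) (u v w : D).

Lemma supnorm_le1 f : (supnorm f <= 1)%E <-> forall x, `|f x| <= 1.
Proof.
split=> [h x|h]; last by apply: ge_ereal_sup => _ [x _ <-]; rewrite lee_fin.
by rewrite -lee_fin; apply: le_trans h; apply: ereal_sup_ubound; exists x.
Qed.

(** Real-valued and defined on all functions; 0 is a dummy value off [D]. *)
Definition realext rho f : R :=
  if pselect (D f) is left h then fine (rho (elt h)) else 0.

Lemma realextE rho u : realext rho (\val u) = fine (rho u).
Proof.
rewrite /realext; case: pselect => [h|/(_ (set_valP u))//].
by congr (fine (rho _)); exact: val_inj.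
Qed.

Lemma functional_fin rho : D !=set0 -> (forall u, rho u \is a fin_num) ->
  functional rho.
Proof.
move=> [f Df] fin; split.
- by move=> [[u eu] _]; have := fin u; rewrite eu.
- by move=> /(_ (elt Df)) eu; have := fin (elt Df); rewrite eu.
- by move=> /(_ (elt Df)) eu; have := fin (elt Df); rewrite eu.
- by move=> u _.
Qed.

Lemma bounded_functional_fin rho M :
  (forall u, (forall x, `|\val u x| <= 1) -> (`|rho u| <= M%:E)%E) ->
  bounded_functional rho.
Proof.
move=> h; apply: le_lt_trans (_ : M%:E < +oo)%E; last by rewrite ltry.
apply: ge_ereal_sup => _ [u /= su <-]; apply: h.
by apply/supnorm_le1.
Qed.

Lemma bounded_functional_le rho u : bounded_functional rho ->
  (forall x, `|\val u x| <= 1) -> (`|rho u| <= (fine (fnorm rho))%:E)%E.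
Proof.
move=> brho u1; have h : (`|rho u| <= fnorm rho)%E.
  by apply: ereal_sup_ubound; exists u => //; apply/supnorm_le1.
by rewrite fineK// ge0_fin_numE//; exact: le_trans h.
Qed.

Hypothesis D_bounded : forall f, D f -> bounded_cts f.
Hypothesis D_scale : forall f a, D f -> 0 < a -> D (scalec f a).

(** Rescaling brings any bounded function into the unit ball. *)
Lemma bounded_homogeneous_fin rho u : pos_homogeneous rho ->
  bounded_functional rho -> rho u \is a fin_num.
Proof.
move=> hom brho; have Du := set_valP u; have [b hb] := D_bounded Du.
pose c := Num.max 1 b; have c0 : 0 < c by rewrite lt_max ltr01.
have ci : 0 < c^-1 by rewrite invr_gt0.
pose v := elt (D_scale Du ci).
have v1 x : `|\val v x| <= 1.
  rewrite /= /mkcts normrM gtr0_norm// mulrC ler_pdivrMr// mul1r.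
  by rewrite le_max hb orbT.
have vfin : rho v \is a fin_num.
  rewrite -abse_fin_num ge0_fin_numE//.
  by apply: le_lt_trans (bounded_functional_le brho v1) _; rewrite ltry.
rewrite (hom v u c)//; first exact: fin_numM.
by move=> x; rewrite /= /mkcts mulrA divff ?mul1r// gt_eqF.
Qed.

End FunctionalsOnDomains.

Section Comparison.
Context (X : topologicalType) (R : realType).
Implicit Types f g h : continuousType X R.

Lemma Aplus_of f g (phi : R -> R) :
  continuous phi -> {homo phi : s t / s <= t} ->
  (~ compact [set: X] -> phi 0 = 0) -> (forall x, g x = phi (f x)) -> Aplus f g.
Proof.
move=> cphi hphi phi0 gE; exists phi; split => //.
- exact: continuous_subspaceT.
- by move=> s t _ _; exact: hphi.
Qed.

Lemma Aplus_id f : Aplus f f.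
Proof. by apply: (@Aplus_of f f id) => // t; exact: cvg_id. Qed.

Lemma Aplus_minc f c : 0 <= c -> Aplus f (minc f c).
Proof.
move=> c0; apply: (@Aplus_of _ _ (fun t => Num.min t c)) => //.
- by move=> t; apply: (@continuous_min R _ id (cst c));
    [exact: cvg_id|exact: cvg_cst].
- by move=> s t st; rewrite le_min !ge_min st lexx orbT.
- by move=> _; exact/min_idPl.
Qed.

Lemma Aplus_excess f c : 0 <= c -> Aplus f (excess f c).
Proof.
move=> c0; apply: (@Aplus_of _ _ (fun t => Num.max (t - c) 0)) => //.
- move=> t; apply: (@continuous_max R _ (fun t => t - c) (cst 0));
    last exact: cvg_cst.
  by apply: cvgB; [exact: cvg_id|exact: cvg_cst].
- by move=> s t st; rewrite ge_max !le_max lexx orbT lerD2r st.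
- by move=> _; apply/max_idPr; rewrite sub0r oppr_le0.
Qed.

Lemma Aplus_const f g c : compact [set: X] -> (forall x, g x = c) -> Aplus f g.
Proof. by move=> cX gE; apply: (@Aplus_of _ _ (cst c)) => // t;
  exact: cvg_cst. Qed.

Lemma Aplus_Aminus f g : Aplus f g -> Aminus f (oppc g).
Proof.
move=> [phi [cphi hphi phi0 gE]]; exists (fun t => - phi t); split.
- by move=> t; apply: cvgN; exact: cphi.
- by move=> s t sC tC st; rewrite lerN2 hphi.
- by move=> /phi0 ->; rewrite oppr0.
- by move=> x /=; rewrite /mkcts gE.
Qed.

Lemma Aminus_Aplus f g : Aminus f g -> Aplus f (oppc g).
Proof.
move=> [phi [cphi hphi phi0 gE]]; exists (fun t => - phi t); split.
- by move=> t; apply: cvgN; exact: cphi.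
- by move=> s t sC tC st; rewrite lerN2 hphi.
- by move=> /phi0 ->; rewrite oppr0.
- by move=> x /=; rewrite /mkcts gE.
Qed.

Lemma oppcK f : oppc (oppc f) = f.
Proof. by apply: cts_ext => x; rewrite /= /mkcts opprK. Qed.

Lemma minc_excess f c x : f x = minc f c x + excess f c x.
Proof.
rewrite /= /mkcts; have [h|h] := leP (f x) c.
  by rewrite (max_idPr _) ?addr0// subr_le0.
by rewrite (max_idPl _) ?subr_ge0 1?ltW// addrC subrK.
Qed.

Lemma C0p_C0n f : C0p X R f -> C0n X R (oppc f).
Proof. by move=> [c0 f0]; split; [exact: C0_opp|move=> x;
  rewrite /= /mkcts oppr_le0]. Qed.

Lemma C0n_C0p f : C0n X R f -> C0p X R (oppc f).
Proof. by move=> [c0 f0]; split; [exact: C0_opp|move=> x;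
  rewrite /= /mkcts oppr_ge0]. Qed.

Section PConic.
Variable rho : C0p X R -> \bar R.
Hypothesis hrho : Phi_p (C0p X R) rho.

Lemma p_conic_homogeneous : pos_homogeneous rho.
Proof.
case: hrho => -[_ _ _ p3] _ f h a a0 hE.
have [cf _] := set_valP f.
rewrite (p3 _ cf f f h a 0 (Aplus_id _) (Aplus_id _) (ltW a0) (lexx 0)).
  by rewrite mul0e adde0.
by move=> x; rewrite mul0r addr0.
Qed.

Lemma p_conic_real u : rho u = (realext rho (\val u))%:E.
Proof.
rewrite realextE fineK//; case: hrho => _ brho.
apply: bounded_homogeneous_fin brho => //.
- by move=> f [cf _]; exact: C0_bounded_cts.
- by move=> f a hf a0; apply: C0p_scalec => //; exact: ltW.
- exact: p_conic_homogeneous.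
Qed.

Lemma p_conic_posfun : rho = posfun (realext rho).
Proof. by apply/funext => u; exact: p_conic_real. Qed.

(** The truncation of [f] at [c] and the excess over [c] are non-decreasing functions
of [f] vanishing at 0, so the layer property is an instance of additivity on
[Aplus f]. *)
Lemma p_conic_layered : layered (realext rho) (fine (fnorm rho)).
Proof.
case: hrho => -[_ p1 p2 p3] brho; split.
- move=> f g h hf hg fg0 hE.
  have hh : C0p X R h.
    by rewrite (_ : h = addc f g); [exact: C0p_addc|exact: cts_ext].
  have := p1 (elt hf) (elt hg) (elt hh) fg0 hf.2 hg.2 hE.
  by rewrite !p_conic_real -EFinD => -[].
- move=> f g hf hg gf.
  have := p2 (elt hf) (elt hg) (fun x => introT andP (conj (hg.2 x) (gf x))).
  by rewrite !p_conic_real lee_fin.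
- move=> f a hf a0; have hh := C0p_scalec (ltW a0) hf.
  have := p_conic_homogeneous (f := elt hf) (h := elt hh) a0 (fun x => erefl).
  by rewrite !p_conic_real -EFinM => -[].
- move=> f c hf c0.
  have hm := C0p_minc c0 hf; have he := C0p_excess c0 hf.
  have := p3 f hf.1 (elt hm) (elt he) (elt hf) 1 1 (Aplus_minc _ c0)
    (Aplus_excess _ c0) ler01 ler01.
  have e x : f x = 1 * minc f c x + 1 * excess f c x.
    by rewrite !mul1r; exact: minc_excess.
  by move=> /(_ e); rewrite !mul1e !p_conic_real -EFinD => -[].
- move=> f hf f1; have := @bounded_functional_le _ _ _ rho (elt hf) brho.
  have h1 x : `|f x| <= 1 by rewrite ger0_norm; [exact: f1|exact: hf.2].
  move=> /(_ h1); rewrite p_conic_real /= lee_fin.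
  exact: le_trans (ler_norm _).
Qed.

End PConic.
End Comparison.

Section NConic.
Context (X : topologicalType) (R : realType).
Implicit Types f g h k : continuousType X R.
Variable rho : C0n X R -> \bar R.
Hypothesis hrho : Phi_n (C0n X R) rho.

Lemma C0n_Aminus f : Aminus (oppc f) f.
Proof.
exists (fun t => - t); split => //.
- by apply: continuous_subspaceT => t; apply: cvgN; exact: cvg_id.
- by move=> s t _ _ st; rewrite lerN2.
- by rewrite oppr0.
- by move=> x; rewrite /= /mkcts opprK.
Qed.

Lemma n_conic_homogeneous : pos_homogeneous rho.
Proof.
case: hrho => -[_ _ _ n3] _ f h a a0 hE.
have [cf _] := set_valP f.
rewrite (n3 _ (C0_opp cf) f f h a 0 (C0n_Aminus _) (C0n_Aminus _) (ltW a0) (lexx 0)).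
  by rewrite mul0e adde0.
by move=> x; rewrite mul0r addr0.
Qed.

Lemma n_conic_real u : rho u = (realext rho (\val u))%:E.
Proof.
rewrite realextE fineK//; case: hrho => _ brho.
apply: bounded_homogeneous_fin brho => //.
- by move=> f [cf _]; exact: C0_bounded_cts.
- move=> f a [cf f0] a0; split; first exact: C0_scale.
  by move=> x; rewrite /= /mkcts pmulr_rle0.
- exact: n_conic_homogeneous.
Qed.

(** After reflection, truncations and excesses become non-increasing functions of [f],
to which additivity on [Aminus f] applies. *)
Lemma n_conic_layered :
  layered (fun f => - realext rho (oppc f)) (fine (fnorm rho)).
Proof.
case: hrho => -[_ n1 n2 n3] brho; split.
- move=> f g h hf hg fg0 hE.
  have hh : C0p X R h.
    by rewrite (_ : h = addc f g); [exact: C0p_addc|exact: cts_ext].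
  have := n1 (elt (C0p_C0n hf)) (elt (C0p_C0n hg)) (elt (C0p_C0n hh)).
  have e1 x : oppc f x * oppc g x = 0 by rewrite /= /mkcts mulrNN.
  have e2 x : oppc h x = oppc f x + oppc g x by rewrite /= /mkcts hE opprD.
  move=> /(_ e1 (C0p_C0n hf).2 (C0p_C0n hg).2 e2).
  by rewrite !n_conic_real -EFinD => -[] /= ->; rewrite opprD.
- move=> f g hf hg gf.
  have := n2 (elt (C0p_C0n hf)) (elt (C0p_C0n hg)).
  have e x : oppc f x <= oppc g x <= 0.
    by rewrite (C0p_C0n hg).2 andbT /= /mkcts lerN2.
  by move=> /(_ e); rewrite !n_conic_real lee_fin lerN2.
- move=> f a hf a0; have hh := C0p_C0n (C0p_scalec (ltW a0) hf).
  have := n_conic_homogeneous (f := elt (C0p_C0n hf)) (h := elt hh) a0.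
  have e x : oppc (scalec f a) x = a * oppc f x by rewrite /= /mkcts mulrN.
  by move=> /(_ e); rewrite !n_conic_real -EFinM => -[] /= ->; rewrite mulrN.
- move=> f c hf c0.
  have hm := C0p_C0n (C0p_minc c0 hf); have he := C0p_C0n (C0p_excess c0 hf).
  have := n3 f hf.1 (elt hm) (elt he) (elt (C0p_C0n hf)) 1 1
    (Aplus_Aminus (Aplus_minc _ c0)) (Aplus_Aminus (Aplus_excess _ c0)) ler01 ler01.
  have e x : oppc f x = 1 * oppc (minc f c) x + 1 * oppc (excess f c) x.
    by rewrite !mul1r -[LHS]/(- f x) (minc_excess f c) opprD.
  by move=> /(_ e); rewrite !mul1e !n_conic_real -EFinD => -[] /= ->;
    rewrite opprD.
- move=> f hf f1; have := @bounded_functional_le _ _ _ rho (elt (C0p_C0n hf)) brho.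
  have h1 x : `|oppc f x| <= 1.
    by rewrite /= /mkcts normrN ger0_norm; [exact: f1|exact: hf.2].
  move=> /(_ h1); rewrite n_conic_real /= lee_fin.
  by apply: le_trans; rewrite -normrN ler_norm.
Qed.

End NConic.

Section RFunctional.
Context (X : topologicalType) (R : realType).
Implicit Types f g h k : continuousType X R.
Hypothesis cX : compact [set: X].

Section Layered.
Variable rho : Cfun X R -> \bar R.
Hypothesis hrho : Phi_r (Cfun X R) rho.

Definition Cfun_elt f : Cfun X R := elt (I : Cfun X R f).

Lemma r_functional_real u : rho u = (realext rho (\val u))%:E.
Proof.
rewrite realextE fineK//; case: hrho => -[_ hom _ _ _] brho.
by apply: bounded_homogeneous_fin brho => // f _; apply: C0_bounded_cts;
  exact: compact_C0.
Qed.

Lemma r_functional_const f h k c : (forall x, k x = c) ->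
  (forall x, h x = f x + c) -> realext rho h = realext rho f + realext rho k.
Proof.
case: hrho => -[_ _ _ _ cst] _ kE hE.
by have := cst (Cfun_elt f) (Cfun_elt k) (Cfun_elt h) c kE hE;
  rewrite !r_functional_real -EFinD => -[].
Qed.

Lemma r_functional_disjoint f g h : (forall x, f x * g x = 0) ->
  (forall x, 0 <= f x) -> (forall x, 0 <= g x) \/ (forall x, g x <= 0) ->
  (forall x, h x = f x + g x) -> realext rho h = realext rho f + realext rho g.
Proof.
case: hrho => -[_ _ _ add _] _ fg0 f0 sg hE.
have := add (Cfun_elt f) (Cfun_elt g) (Cfun_elt h) fg0 _ hE;
  rewrite !r_functional_real -EFinD.
by case: sg => sg; [move=> /(_ (or_introl (conj f0 sg)))|move=> /(_ (or_intror (conj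
  f0 sg)))] => -[].
Qed.

(** [f - c] is the sum of the nonnegative [excess f c] and the nonpositive
[minc f c - c], whose product is 0. *)
Lemma r_functional_layered : layered (realext rho) (fine (fnorm rho)).
Proof.
case: (hrho) => -[_ hom mono add _] brho; split.
- move=> f g h hf hg fg0 hE.
  by apply: r_functional_disjoint => //; [case: hf|left; case: hg].
- move=> f g hf hg gf.
  have := mono (Cfun_elt f) (Cfun_elt g) (fun x => introT andP (conj (hg.2 x) (gf x))).
  by rewrite !r_functional_real lee_fin.
- move=> f a hf a0; have := hom (Cfun_elt f) (Cfun_elt (scalec f a)) a a0 (fun x => erefl).
  by rewrite !r_functional_real -EFinM => -[].
- move=> f c hf c0.
  (* the value at the constant [- c] enters on both sides and cancels *)
  have e1 := @r_functional_const f (shiftc f (- c)) (constc X (- c)) (- c)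
    (fun x => erefl) (fun x => erefl).
  have e2 := @r_functional_const (minc f c) (shiftc (minc f c) (- c)) (constc X (- c)) (- c)
    (fun x => erefl) (fun x => erefl).
  have := @r_functional_disjoint (excess f c) (shiftc (minc f c) (- c)) (shiftc f (- c)).
  rewrite {}e1 {}e2 => H;
  have d1 x : excess f c x * shiftc (minc f c) (- c) x = 0.
    rewrite /= /mkcts; have [h|h] := leP (f x) c.
      by rewrite (max_idPr _) ?mul0r// subr_le0.
    by rewrite subrr mulr0.
  have d2 x : 0 <= excess f c x by rewrite /= /mkcts le_max lexx orbT.
  have d3 x : shiftc (minc f c) (- c) x <= 0.
    by rewrite /= /mkcts subr_le0 ge_min lexx orbT.
  have d4 x : shiftc f (- c) x = excess f c x + shiftc (minc f c) (- c) x.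
    rewrite -[LHS]/(f x - c) (minc_excess f c) -[shiftc _ _ x]/(minc f c x - c).
    by rewrite addrA (addrC (excess f c x)).
  have := H d1 d2 (or_intror d3) d4.
  move: (realext rho _) (realext rho _) (realext rho _) (realext rho _) => x y z t.
  by move=> h; lra.
- move=> f hf f1; have := @bounded_functional_le _ _ _ rho (Cfun_elt f) brho.
  have h1 x : `|f x| <= 1 by rewrite ger0_norm; [exact: f1|exact: hf.2].
  move=> /(_ h1); rewrite r_functional_real /= lee_fin.
  exact: le_trans (ler_norm _).
Qed.

End Layered.

(** The reflection [f |-> - f] exchanges r- and l-functionals. *)
Definition conjf (rho : Cfun X R -> \bar R) : Cfun X R -> \bar R :=
  fun u => (- rho (Cfun_elt (oppc (\val u))))%E.

Lemma conjfK rho : conjf (conjf rho) = rho.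
Proof.
apply/funext => u; rewrite /conjf oppeK; congr rho; apply: val_inj => /=.
exact: oppcK.
Qed.

Lemma conjf_functional rho : functional rho -> functional (conjf rho).
Proof.
move=> [h1 h2 h3 h4];
  have e u : rho u = (- conjf rho (Cfun_elt (oppc (\val u))))%E.
  by rewrite -[in LHS](conjfK rho).
split.
- move=> [[u /eqP uy] [v /eqP vy]]; apply: h1; split.
    by exists (Cfun_elt (oppc (\val v))); move: vy;
      rewrite /conjf eqe_oppLR => /eqP.
  by exists (Cfun_elt (oppc (\val u))); move: uy;
    rewrite /conjf eqe_oppLR => /eqP.
- by move=> h; apply: h3 => u; rewrite e h.
- by move=> h; apply: h2 => u; rewrite e h.
- move=> u u0; rewrite /conjf fin_numN; apply: h4 => x.
  by rewrite /= /mkcts u0 oppr0.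
Qed.

Lemma conjf_bounded rho : bounded_functional rho -> bounded_functional (conjf rho).
Proof.
apply: le_lt_trans; apply: ge_ereal_sup => _ [u /= su <-].
rewrite /conjf abseN; apply: ereal_sup_ubound;
  exists (Cfun_elt (oppc (\val u))) => //=.
by apply/supnorm_le1 => x; rewrite /= /mkcts normrN; move/supnorm_le1 : su.
Qed.

Lemma conjf_homogeneous rho : pos_homogeneous rho -> pos_homogeneous (conjf rho).
Proof.
move=> hom f h a a0 hE; rewrite /conjf (hom (Cfun_elt (oppc (\val f))) _ a)//.
  by rewrite muleN.
by move=> x; rewrite /= /mkcts hE mulrN.
Qed.

Lemma conjf_const rho : (forall u, rho u \is a fin_num) ->
  additive_const rho -> additive_const (conjf rho).
Proof.
move=> fin ac f k h c kE hE.
rewrite /conjf (ac (Cfun_elt (oppc (\val f))) (Cfun_elt (oppc (\val k))) _ (- c)).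
- by rewrite oppeD// fin_num_adde_defl.
- by move=> x; rewrite /= /mkcts kE.
- by move=> x; rewrite /= /mkcts hE opprD.
Qed.

Lemma Cfun_fin rho : pos_homogeneous rho -> bounded_functional rho ->
  forall u : Cfun X R, rho u \is a fin_num.
Proof.
move=> hom brho u.
by apply: bounded_homogeneous_fin brho => // f _; apply: C0_bounded_cts;
  exact: compact_C0.
Qed.

Lemma conjf_rl rho : Phi_r (Cfun X R) rho -> Phi_l (Cfun X R) (conjf rho).
Proof.
move=> [[fn hom mono add ac] brho]; have fin := Cfun_fin hom brho.
split; last exact: conjf_bounded.
split; [exact: conjf_functional|exact: conjf_homogeneous| | |exact: conjf_const].
- move=> f g fg; rewrite /conjf leeN2; apply: mono => x;
    have /andP[h1 h2] := fg x.
  by rewrite /= /mkcts oppr_ge0 h2 lerN2.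
- move=> f g h fg0 sg hE.
  have hE' x : oppc (\val h) x = oppc (\val f) x + oppc (\val g) x.
    by rewrite /= /mkcts hE opprD.
  have fg0' x : oppc (\val f) x * oppc (\val g) x = 0 by rewrite /= /mkcts mulrNN.
  have fg0'' x : oppc (\val g) x * oppc (\val f) x = 0 by rewrite mulrC.
  rewrite /conjf; case: sg => -[f0 g0].
    rewrite (add (Cfun_elt (oppc (\val f))) (Cfun_elt (oppc (\val g))))//.
      by rewrite oppeD// fin_num_adde_defl.
    by left; split => x; rewrite /= /mkcts oppr_ge0.
  rewrite (add (Cfun_elt (oppc (\val g))) (Cfun_elt (oppc (\val f))))//.
  - by rewrite oppeD ?fin_num_adde_defl// addeC.
  - by right; split => x; rewrite /= /mkcts ?oppr_ge0 ?oppr_le0.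
  - by move=> x; rewrite addrC; exact: hE'.
Qed.

Lemma conjf_lr rho : Phi_l (Cfun X R) rho -> Phi_r (Cfun X R) (conjf rho).
Proof.
move=> [[fn hom mono add ac] brho]; have fin := Cfun_fin hom brho.
split; last exact: conjf_bounded.
split; [exact: conjf_functional|exact: conjf_homogeneous| | |exact: conjf_const].
- move=> f g fg; rewrite /conjf leeN2; apply: mono => x;
    have /andP[h1 h2] := fg x.
  by rewrite /= /mkcts oppr_le0 h1 lerN2 h2.
- move=> f g h fg0 sg hE.
  have hE' x : oppc (\val h) x = oppc (\val f) x + oppc (\val g) x.
    by rewrite /= /mkcts hE opprD.
  have fg0' x : oppc (\val f) x * oppc (\val g) x = 0 by rewrite /= /mkcts mulrNN.
  have fg0'' x : oppc (\val g) x * oppc (\val f) x = 0 by rewrite mulrC.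
  rewrite /conjf; case: sg => -[f0 g0].
    rewrite (add (Cfun_elt (oppc (\val f))) (Cfun_elt (oppc (\val g))))//.
      by rewrite oppeD// fin_num_adde_defl.
    by left; split => x; rewrite /= /mkcts oppr_le0.
  rewrite (add (Cfun_elt (oppc (\val g))) (Cfun_elt (oppc (\val f))))//.
  - by rewrite oppeD ?fin_num_adde_defl// addeC.
  - by right; split => x; rewrite /= /mkcts ?oppr_ge0 ?oppr_le0.
  - by move=> x; rewrite addrC; exact: hE'.
Qed.

End RFunctional.

Section IntegralFunctionals.
Context (X : topologicalType) (R : realType).
Hypotheses (hX : hausdorff_space X) (cnX : connected [set: X]).
Variable mu : DTM X R.
Implicit Types f g h k : continuousType X R.

Lemma qint_norm f : bounded_cts f -> (forall x, `|f x| <= 1) ->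
  `|qint mu f| <= dval mu setT.
Proof.
move=> bf f1; rewrite ler_norml -[X in - X <= _]mul1r -mulNr -[X in _ <= _ <= X]mul1r.
by rewrite qint_ge ?qint_le// => x; have := f1 x; rewrite ler_norml => /andP[].
Qed.

Lemma calR_real (D : set (continuousType X R)) (u : D) : bounded_cts (\val u) ->
  calR D mu u = (qint mu (\val u))%:E.
Proof. exact: Rint_qint. Qed.

Lemma calR_p_conic : Phi_p (C0p X R) (calR (C0p X R) mu).
Proof.
have bf (u : C0p X R) : bounded_cts (\val u) by apply: C0_bounded_cts;
  case: (set_valP u).
have E (u : C0p X R) : calR _ mu u = (qint mu (\val u))%:E by exact: calR_real.
split; last first.
  apply: (@bounded_functional_fin _ _ _ _ (dval mu setT)) => u u1.
  by rewrite E lee_fin; exact: qint_norm.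
split.
- by apply: functional_fin => [|u]; [exists (constc X 0);
    exact: C0p_constc0|rewrite E].
- move=> f g h fg0 f0 g0 hE; rewrite !E -EFinD.
  by rewrite (qint_disjoint hX mu (bf f) (bf g) (bf h))//; left.
- move=> f g fg; rewrite !E lee_fin qint_homo// => x; by case/andP: (fg x).
- move=> u cu g h k a b ug uh a0 b0 kE; rewrite !E -!EFinM -EFinD.
  by rewrite (qint_Aplus hX mu cnX (C0_bounded_cts cu) ug uh a0 b0 kE).
Qed.

Lemma calL_n_conic : Phi_n (C0n X R) (calL (C0n X R) mu).
Proof.
have bf (u : C0n X R) : bounded_cts (\val u) by apply: C0_bounded_cts;
  case: (set_valP u).
have bo (u : C0n X R) : bounded_cts (oppc (\val u)) by apply: bounded_cts_opp;
  exact: bf.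
have E (u : C0n X R) : calL _ mu u = (- qint mu (oppc (\val u)))%:E by exact: Lint_qint.
split; last first.
  apply: (@bounded_functional_fin _ _ _ _ (dval mu setT)) => u u1.
  rewrite E lee_fin normrN; apply: qint_norm => // x.
  by rewrite /= /mkcts normrN; exact: u1.
split.
- apply: functional_fin => [|u]; last by rewrite E.
  by exists (oppc (constc X 0)); apply: C0p_C0n; exact: C0p_constc0.
- move=> f g h fg0 f0 g0 hE; rewrite !E -EFinD.
  rewrite (qint_disjoint hX mu (bo f) (bo g) (bo h)) ?opprD//.
  + by move=> x; rewrite /= /mkcts mulrNN.
  + by move=> x; rewrite /= /mkcts oppr_ge0.
  + by left => x; rewrite /= /mkcts oppr_ge0.
  + by move=> x; rewrite /= /mkcts hE opprD.
- move=> f g fg; rewrite !E lee_fin lerN2 qint_homo// => x.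
  by case/andP: (fg x) => h _; rewrite /= /mkcts lerN2.
- move=> u cu g h k a b ug uh a0 b0 kE; rewrite !E -!EFinM -EFinD.
  rewrite (qint_Aplus hX mu (k := oppc (\val k)) cnX (C0_bounded_cts cu)
    (Aminus_Aplus ug) (Aminus_Aplus uh) a0 b0).
    by rewrite opprD !mulrN.
  by move=> x; rewrite /= /mkcts kE opprD !mulrN.
Qed.

Lemma qint_shift f h k c : compact [set: X] -> (forall x, k x = c) ->
  (forall x, h x = f x + c) -> qint mu h = qint mu f + qint mu k.
Proof.
move=> cX kE hE; have bf : bounded_cts f by apply: C0_bounded_cts;
  exact: compact_C0.
rewrite (qint_Aplus hX mu cnX bf (Aplus_id f) (Aplus_const f cX kE) ler01 ler01);
  last first.
  by move=> x; rewrite !mul1r kE.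
exact: (congr2 +%R (mul1r _) (mul1r _)).
Qed.

Lemma calR_r_functional : compact [set: X] ->
  Phi_r (Cfun X R) (calR (Cfun X R) mu).
Proof.
move=> cX.
have bf f : bounded_cts f by apply: C0_bounded_cts; exact: compact_C0.
have E (u : Cfun X R) : calR _ mu u = (qint mu (\val u))%:E by exact: calR_real.
split; last first.
  apply: (@bounded_functional_fin _ _ _ _ (dval mu setT)) => u u1.
  by rewrite E lee_fin; exact: qint_norm.
split.
- by apply: functional_fin => [|u]; [exists (constc X 0)|rewrite E].
- move=> f h a a0 hE; rewrite !E -EFinM.
  rewrite (qint_Aplus hX mu cnX (bf (\val f)) (Aplus_id _) (Aplus_id _) (ltW a0) (lexx 0)).
    by rewrite mul0r addr0.
  by move=> x; rewrite hE mul0r addr0.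
- by move=> f g fg; rewrite !E lee_fin qint_homo// => x; case/andP: (fg x).
- move=> f g h fg0 sg hE; rewrite !E -EFinD; congr EFin.
  by apply: qint_disjoint => //; case: sg => -[]//; [left|right].
- by move=> f k h c kE hE; rewrite !E -EFinD (qint_shift cX kE hE).
Qed.

End IntegralFunctionals.

(** * The bijections *)
Lemma injective_surjective_bijective (A B : Type) (F : A -> B) :
  injective F -> (forall b, exists a, F a = b) -> bijective F.
Proof.
move=> inj surj; exists (fun b => projT1 (cid (surj b))) => [a|b].
  by apply: inj; case: cid.
by case: cid.
Qed.

Theorem corollary8p5 (R : realType) (X : topologicalType)
    (lcX : locally_compact [set: X]) (hX : hausdorff_space X)
    (cX : connected [set: X]) :
  [/\ (exists Gamma : Phi_p (C0p X R) -> DTM X R,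
        [/\ bijective Gamma,
            (forall rho : Phi_p (C0p X R),
              \val (Gamma rho) = mu_of (\val rho)) &
            exists Pi : DTM X R -> Phi_p (C0p X R),
              [/\ cancel Gamma Pi, cancel Pi Gamma &
                  forall mu : DTM X R, \val (Pi mu) = calR (C0p X R) mu]]),
      (exists Delta : DTM X R -> Phi_n (C0n X R),
        bijective Delta /\
        forall mu : DTM X R, \val (Delta mu) = calL (C0n X R) mu) &
      (compact [set: X] ->
        (exists Theta : DTM X R -> Phi_r (Cfun X R),
          bijective Theta /\
          forall mu : DTM X R, \val (Theta mu) = calR (Cfun X R) mu) /\
        (exists Lambda : DTM X R -> Phi_l (Cfun X R), bijective Lambda))].
Proof.
have calRE (mu : DTM X R) : calR (C0p X R) mu = posfun (qint mu).
  by apply/funext => u; apply: calR_real => //; apply: C0_bounded_cts;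
    case: (set_valP u).
have calLE (mu : DTM X R) (u : C0n X R) :
    calL (C0n X R) mu u = (- qint mu (oppc (\val u)))%:E.
  by apply: Lint_qint => //; apply: C0_bounded_cts; case: (set_valP u).
split.
- have DR (rho : Phi_p (C0p X R)) : DTM X R (mu_of (\val rho)).
    rewrite (p_conic_posfun (set_valP rho)).
    exact: mu_of_DTM (p_conic_layered (set_valP rho)) hX lcX.
  pose Gamma (rho : Phi_p (C0p X R)) : DTM X R := elt (DR rho).
  pose Pi (mu : DTM X R) : Phi_p (C0p X R) :=
    elt (calR_p_conic hX cX mu).
  have GP : cancel Gamma Pi.
    move=> rho; apply: val_inj; rewrite /= calRE.
    have -> : Gamma rho = dtm_of_layered hX lcX (p_conic_layered (set_valP rho)).
      apply: val_inj => /=; congr mu_of.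
      exact: p_conic_posfun (set_valP rho).
    apply/funext => u; rewrite (p_conic_real (set_valP rho)) /posfun.
    by rewrite -(layered_qint hX lcX (p_conic_layered (set_valP rho)))//;
      exact: set_valP.
  have PG : cancel Pi Gamma.
    move=> mu; apply: val_inj; rewrite /= calRE; exact: mu_of_qint.
  exists Gamma; split => //; first by exists Pi.
  by exists Pi; split.
- exists (fun mu => elt (calL_n_conic hX cX mu)).
  split => //; apply: injective_surjective_bijective.
    move=> mu nu /(congr1 val) /= e; apply: (qint_inj hX lcX) => f hf.
    have := congr1 (fun rho => rho (elt (C0p_C0n hf))) e.
    move=> h; have := eq_trans (esym (calLE mu _)) (eq_trans h (calLE nu _)).
    by rewrite /= oppcK; move: (qint mu f) (qint nu f) => x y -[] /oppr_inj.
  move=> rho; have hl := n_conic_layered (set_valP rho).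
  exists (dtm_of_layered hX lcX hl); apply: val_inj; apply/funext => u /=.
  rewrite calLE -(layered_qint hX lcX hl); last by apply: C0n_C0p;
    exact: set_valP.
  by rewrite opprK oppcK (n_conic_real (set_valP rho)).
move=> cpX.
pose Theta (mu : DTM X R) : Phi_r (Cfun X R) :=
  elt (calR_r_functional hX cX mu cpX).
have RE (mu : DTM X R) (u : Cfun X R) : \val (Theta mu) u = (qint mu (\val u))%:E.
  by apply: calR_real => //; apply: C0_bounded_cts; exact: compact_C0.
have bT : bijective Theta.
  apply: injective_surjective_bijective.
    move=> mu nu /(congr1 val) e; apply: (qint_inj hX lcX) => f hf.
    have := congr1 (fun rho => rho (Cfun_elt f)) e.
    move=> h; have := eq_trans (esym (RE mu _)) (eq_trans h (RE nu _)).
    by rewrite /=; move: (qint mu f) (qint nu f) => x y -[].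
  move=> rho; have hr := set_valP rho; have hl := r_functional_layered cpX hr.
  exists (dtm_of_layered hX lcX hl); apply: val_inj; apply/funext => u.
  rewrite RE (r_functional_real cpX hr); congr EFin.
  have [b b0 hb] := bounded_cts_bound (C0_bounded_cts (@compact_C0 _ _ (\val u) cpX)).
  (* [u + b] and [b] are nonnegative, and both functionals are additive on this sum *)
  pose k := constc X b; pose v := shiftc (\val u) b.
  have hk : C0p X R k by split; [exact: compact_C0|].
  have hv : C0p X R v.
    split; [exact: compact_C0|move=> x].
    by rewrite /v /= /mkcts -lerBlDr sub0r; case/andP: (hb x).
  have e1 := qint_shift hX cX (dtm_of_layered hX lcX hl) (f := \val u) (h := v) (k := k) cpX
    (fun x => erefl b) (fun x => erefl).
  have e2 := r_functional_const cpX hr (f := \val u) (h := v) (k := k)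
    (fun x => erefl b) (fun x => erefl).
  move: e1; rewrite -(layered_qint hX lcX hl hv) -(layered_qint hX lcX hl hk) e2.
  by move/addIr.
split; first by exists Theta.
pose Lambda (mu : DTM X R) : Phi_l (Cfun X R) :=
  elt (conjf_rl cpX (set_valP (Theta mu))).
exists Lambda; case: bT => Xi TX XT.
exists (fun rho => Xi (elt (conjf_lr cpX (set_valP rho)))).
- move=> mu; rewrite -[RHS]TX; congr Xi; apply: val_inj => /=.
  exact: conjfK.
- move=> rho; apply: val_inj; set rho' := elt _.
  transitivity (conjf (\val (Theta (Xi rho')))); first by [].
  by rewrite XT; exact: conjfK.
Qed.
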